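(* If $w_j=0$ for all $j\in\mathcal M$, then Problem QRAP-NonSep-GBC can be solved in $O(n)$ time; that is, there is an algorithm that, for every feasible instance with $w_j=0$ for all $j\in\mathcal M$, computes its optimal solution in $O(n)$ time.
   Context: Let $\mathcal N=\{1,\dots,n\}$ be partitioned into disjoint nonempty sets $\mathcal N_1,\dots,\mathcal N_m$, and let $\mathcal M=\{1,\dots,m\}$. Given $w,L,U\in\mathbb R^m$, $a\in\mathbb R^n_{>0}$, $b,l,u\in\mathbb R^n$, and $R\in\mathbb R$, Problem QRAP-NonSep-GBC is $$\min_{x\in\mathbb R^n}\ \sum_{j=1}^m\tfrac12 w_j\Big(\sum_{i\in\mathcal N_j}x_i\Big)^2+\sum_{i=1}^n\big(\tfrac12a_ix_i^2+b_ix_i\big)$$ subject to $\sum_{i=1}^n x_i=R$, $\ L_j\le\sum_{i\in\mathcal N_j}x_i\le U_j$ ($j\in\mathcal M$), $\ l_i\le x_i\le u_i$ ($i\in\mathcal N$). Time is counted in arithmetic operations and comparisons of real numbers, each of unit cost. *)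

(* Defs.v *)
(* MathComp / MathComp-Analysis world. *)
From HB Require Import structures.
From mathcomp Require Import all_boot all_order all_algebra.
From mathcomp Require Import reals.

Set Implicit Arguments.
Unset Strict Implicit.
Unset Printing Implicit Defensive.

Import Order.TTheory GRing.Theory Num.Theory.

Local Open Scope ring_scope.

(** * The optimization problem *)

(* Indices are 0-based.  The partition N_1, ..., N_m is given by the map [blk]
   sending an index to the block containing it; surjectivity of [blk] says that
   no block is empty. *)
Record instance (R : realType) (n m : nat) := Instance {
  blk : 'I_n -> 'I_m;
  w : 'I_m -> R;
  L : 'I_m -> R;
  U : 'I_m -> R;
  a : 'I_n -> R;
  b : 'I_n -> R;
  l : 'I_n -> R;
  u : 'I_n -> R;
  res : R;
  blk_surj : forall j, exists i, blk i = j;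
  a_gt0 : forall i, 0 < a i
}.

Definition block (R : realType) (n m : nat) (I : instance R n m) (j : 'I_m) :
  {set 'I_n} := [set i | blk I i == j].

Definition objective (R : realType) (n m : nat) (I : instance R n m)
    (x : 'I_n -> R) : R :=
  \sum_(j < m) 2^-1 * w I j * (\sum_(i in block I j) x i) ^+ 2
  + \sum_(i < n) (2^-1 * a I i * x i ^+ 2 + b I i * x i).

Definition feasible (R : realType) (n m : nat) (I : instance R n m)
    (x : 'I_n -> R) : Prop :=
  [/\ \sum_(i < n) x i = res I,
      forall j, L I j <= \sum_(i in block I j) x i <= U I j &
      forall i, l I i <= x i <= u I i].

Definition optimal (R : realType) (n m : nat) (I : instance R n m)
    (x : 'I_n -> R) : Prop :=
  feasible I x /\ forall y, feasible I y -> objective I x <= objective I y.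

(** * Real RAM programs *)

(* The memory consists of arrays of natural numbers (for indices) and arrays of
   real numbers.  Array names are literals of the program text, so a program
   uses finitely many arrays; the cells of an array are addressed by computed
   natural numbers.  Real numbers influence the control flow only through the
   comparison [BLeR], and cannot be converted to natural numbers. *)
Inductive nexp : Type :=
| NConst of nat
| NGet of nat & nexp
| NAdd of nexp & nexp
| NSub of nexp & nexp.

Inductive rexp : Type :=
| RConst of int
| RGet of nat & nexp
| RAdd of rexp & rexp
| RSub of rexp & rexp
| RMul of rexp & rexp
| RDiv of rexp & rexp.

Inductive bexp : Type :=
| BLeN of nexp & nexp
| BLeR of rexp & rexp
| BNot of bexp
| BAnd of bexp & bexp.

(* [SetN x i e] and [SetR x i e] store [e] in cell [i] of array [x].
   [Call f] runs the [f]-th procedure on the global memory: there are neither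
   parameters nor local variables. *)
Inductive cmd : Type :=
| Skip
| SetN of nat & nexp & nexp
| SetR of nat & nexp & rexp
| Seq of cmd & cmd
| If of bexp & cmd & cmd
| While of bexp & cmd
| Call of nat.

Record program := Program { main : cmd; procs : seq cmd }.

Record state (R : realType) := State {
  nmem : nat -> nat -> nat;
  rmem : nat -> nat -> R
}.

Definition upd (T : Type) (M : nat -> nat -> T) (x i : nat) (v : T) :
    nat -> nat -> T :=
  fun y k => if (y == x) && (k == i) then v else M y k.

Fixpoint neval (R : realType) (s : state R) (e : nexp) : nat :=
  match e with
  | NConst k => k
  | NGet x i => nmem s x (neval s i)
  | NAdd e1 e2 => (neval s e1 + neval s e2)%N
  | NSub e1 e2 => (neval s e1 - neval s e2)%N
  end.

(* Division by zero yields 0; a program can test the divisor at constant cost,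
   so this convention affects running times by at most a constant factor. *)
Fixpoint reval (R : realType) (s : state R) (e : rexp) : R :=
  match e with
  | RConst z => z%:~R
  | RGet x i => rmem s x (neval s i)
  | RAdd e1 e2 => reval s e1 + reval s e2
  | RSub e1 e2 => reval s e1 - reval s e2
  | RMul e1 e2 => reval s e1 * reval s e2
  | RDiv e1 e2 => reval s e1 / reval s e2
  end.

Fixpoint beval (R : realType) (s : state R) (e : bexp) : bool :=
  match e with
  | BLeN e1 e2 => (neval s e1 <= neval s e2)%N
  | BLeR e1 e2 => reval s e1 <= reval s e2
  | BNot e1 => ~~ beval s e1
  | BAnd e1 e2 => beval s e1 && beval s e2
  end.

(* The cost of an expression is its number of nodes: every arithmetic operation
   and comparison costs one unit, and so does every memory access, constant and
   operation on indices or booleans. *)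
Fixpoint ncost (e : nexp) : nat :=
  match e with
  | NConst _ => 1
  | NGet _ i => (ncost i).+1
  | NAdd e1 e2 | NSub e1 e2 => (ncost e1 + ncost e2).+1
  end.

Fixpoint rcost (e : rexp) : nat :=
  match e with
  | RConst _ => 1
  | RGet _ i => (ncost i).+1
  | RAdd e1 e2 | RSub e1 e2 | RMul e1 e2 | RDiv e1 e2 =>
      (rcost e1 + rcost e2).+1
  end.

Fixpoint bcost (e : bexp) : nat :=
  match e with
  | BLeN e1 e2 => (ncost e1 + ncost e2).+1
  | BLeR e1 e2 => (rcost e1 + rcost e2).+1
  | BNot e1 => (bcost e1).+1
  | BAnd e1 e2 => (bcost e1 + bcost e2).+1
  end.

(* [exec P c s t s']: with procedures [P], the command [c] started in [s] halts
   in [s'] after [t] units of time. *)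
Inductive exec (R : realType) (P : seq cmd) :
    cmd -> state R -> nat -> state R -> Prop :=
| exec_Skip s : exec P Skip s 1 s
| exec_SetN s x i e :
    exec P (SetN x i e) s (ncost i + ncost e).+1
      (State (upd (nmem s) x (neval s i) (neval s e)) (rmem s))
| exec_SetR s x i e :
    exec P (SetR x i e) s (ncost i + rcost e).+1
      (State (nmem s) (upd (rmem s) x (neval s i) (reval s e)))
| exec_Seq c1 c2 s1 s2 s3 t1 t2 :
    exec P c1 s1 t1 s2 -> exec P c2 s2 t2 s3 ->
    exec P (Seq c1 c2) s1 (t1 + t2)%N s3
| exec_If e c1 c2 s s' t :
    exec P (if beval s e then c1 else c2) s t s' ->
    exec P (If e c1 c2) s (bcost e + t).+1 s'
| exec_WhileF e c s :
    ~~ beval s e -> exec P (While e c) s (bcost e).+1 s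
| exec_WhileT e c s1 s2 s3 t1 t2 :
    beval s1 e -> exec P c s1 t1 s2 -> exec P (While e c) s2 t2 s3 ->
    exec P (While e c) s1 (bcost e + t1 + t2).+1 s3
| exec_Call f s s' t :
    exec P (nth Skip P f) s t s' ->
    exec P (Call f) s t.+1 s'.

Lemma exec_det (R : realType) (P : seq cmd) (c : cmd) (s s1 s2 : state R)
    (t1 t2 : nat) :
  exec P c s t1 s1 -> exec P c s t2 s2 -> t1 = t2 /\ s1 = s2.
Proof.
move=> h; elim: h t2 s2 => {c s t1 s1}.
- by move=> s t2 s2 h; inversion h.
- by move=> s x i e t2 s2 h; inversion h.
- by move=> s x i e t2 s2 h; inversion h.
- move=> c1 c2 s1 s2 s3 t1 t2 _ IH1 _ IH2 t s h.
  inversion h as [| | |? ? ? s2' ? ? ? h1 h2| | | |]; subst.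
  by case: (IH1 _ _ h1) => -> e; subst; case: (IH2 _ _ h2) => -> ->.
- move=> e c1 c2 s s' t _ IH t2 s2 h.
  inversion h as [| | | |? ? ? ? ? ? h1| | |]; subst.
  by case: (IH _ _ h1) => -> ->.
- move=> e c s he t2 s2 h.
  inversion h as [| | | | | |? ? ? ? ? ? ? he' h1 h2|]; subst => //.
  by rewrite he' in he.
- move=> e c s1 s2 s3 t1 t2 he _ IH1 _ IH2 t s h.
  inversion h as [| | | | |? ? ? he'|? ? ? ? ? ? ? he' h1 h2|]; subst.
    by rewrite he in he'.
  by case: (IH1 _ _ h1) => -> e'; subst; case: (IH2 _ _ h2) => -> ->.
- move=> f s s' t _ IH t2 s2 h.
  inversion h as [| | | | | | |? ? ? ? h1]; subst.
  by case: (IH _ _ h1) => -> ->.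
Qed.

(** * Input and output conventions *)

Definition load (T : Type) (d : T) (p : nat) (f : 'I_p -> T) (k : nat) : T :=
  if insub k is Some i then f i else d.

(* All cells not holding input data are initially 0. *)
Definition init (R : realType) (n m : nat) (I : instance R n m) : state R :=
  State
    (fun x k => match x with
      | 0 => match k with 0 => n | 1 => m | _ => 0 end
      | 1 => load 0 (fun i => nat_of_ord (blk I i)) k
      | _ => 0
      end%N)
    (fun x k => match x with
      | 0 => load 0 (w I) k
      | 1 => load 0 (L I) k
      | 2 => load 0 (U I) k
      | 3 => load 0 (a I) k
      | 4 => load 0 (b I) k
      | 5 => load 0 (l I) k
      | 6 => load 0 (u I) k
      | 7 => if k is 0%N then res I else 0
      | _ => 0
      end).

(* The output vector is read off cells 0, ..., n-1 of the real array 8. *)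
Definition output (R : realType) (n : nat) (s : state R) (i : 'I_n) : R :=
  rmem s 8 i.

(* Main.v *)
(* With w = 0 the objective is separable, and a one-constraint problem
   (sum x_i = T, l <= x <= u) over a set of indices is solved by
   x_i(lam) = clamp((lam - b_i)/a_i, l_i, u_i) for a multiplier lam with
   sum x_i(lam) = T.  For each block this is done twice, for the smallest and the
   largest sum that its constraints allow, which gives xL and xU.  The problem
   over all indices with bounds xL, xU and T = R has the optimal solution of the
   original problem as its solution: inside a block this replaces lam by its
   projection on [lamL, lamU], and the KKT conditions follow.

   The sum of the x_i(lam) is a constant plus the sum of s (lam - p)^+ over two
   breakpoints p per index, with slopes s = 1/a_i and -1/a_i.  Prune and search
   finds lam in linear time if each pivot has a constant fraction of the
   remaining breakpoints on both sides.  Such a pivot is found without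
   recursion: sort consecutive blocks of 8 cells, keep every fourth cell, and
   repeat with blocks twice as large, so that both the total cost (even with a
   quadratic sort) and the total rank error are geometric series. *)
Require Import Defs.
From mathcomp Require Import all_boot all_order all_algebra.
From mathcomp Require Import reals zify ring lra.

Set Implicit Arguments.
Unset Strict Implicit.
Unset Printing Implicit Defensive.

Import Order.TTheory GRing.Theory Num.Theory.

Local Open Scope ring_scope.

(** * Total correctness with a time bound *)

Section RunPredicate.
Variable R : realType.
Implicit Types (s : state R) (Q : state R -> Prop) (c : cmd).

(** The machine has neither parameters nor local variables, so the recursive median of medians would
    need an explicit stack. In the sampling scheme both series have ratio 1/2. From one level to the
    next the number of cells falls by 4 while the quadratic sort doubles its cost per cell. A sorted
    block loses at most 3 cells above a threshold; the number of blocks falls by 8 while each cell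
    stands for 4 times as many originals.

    The search keeps only an interval at whose ends the sum lies on the two sides of the target [T].
    Breakpoints equal to the pivot are dropped in both directions, so ties do not slow it down.

    Multipliers are not unique, so [lamU < lamL] can occur although the lower target of a block sum
    never exceeds the upper one. The two boundary solutions then coincide on the block, and this
    case needs its own argument wherever the projection onto [[lamL, lamU]] is used.

    The block problems cost a constant times size plus one each. Sizes add up to at most [n], and
    there are at most [n] blocks because none is empty. *)

Definition run c s (K : nat) Q : Prop :=
  exists t s', [/\ exec [::] c s t s', (t <= K)%N & Q s'].

(** Arrays are tracked as a whole and from the program text alone, so that most frame conditions are
    decided by computation. A [Call] counts as writing nothing, which is right for an empty
    procedure list. *)
Fixpoint nmods c : seq nat :=
  match c with
  | SetN x _ _ => [:: x]
  | Seq c1 c2 | If _ c1 c2 => nmods c1 ++ nmods c2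
  | While _ c1 => nmods c1
  | _ => [::]
  end.

Fixpoint rmods c : seq nat :=
  match c with
  | SetR x _ _ => [:: x]
  | Seq c1 c2 | If _ c1 c2 => rmods c1 ++ rmods c2
  | While _ c1 => rmods c1
  | _ => [::]
  end.

Definition frame c s s' : Prop :=
  (forall x k, x \notin nmods c -> nmem s' x k = nmem s x k) /\
  (forall x k, x \notin rmods c -> rmem s' x k = rmem s x k).

Lemma frame_refl c s : frame c s s. Proof. by []. Qed.

Lemma frame_trans c s1 s2 s3 : frame c s1 s2 -> frame c s2 s3 -> frame c s1 s3.
Proof.
by move=> [n1 r1] [n2 r2]; split=> x k h; [rewrite n2 ?n1|rewrite r2 ?r1].
Qed.

Lemma frame_sub c c' s s' : {subset nmods c <= nmods c'} ->
  {subset rmods c <= rmods c'} -> frame c s s' -> frame c' s s'.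
Proof.
by move=> sn sr [n r]; split=> x k h; [apply: n|apply: r];
  apply: contra h; [apply: sn|apply: sr].
Qed.

Lemma frame_seql c1 c2 s s' : frame c1 s s' -> frame (Seq c1 c2) s s'.
Proof. by apply: frame_sub => x; rewrite /= mem_cat => ->. Qed.

Lemma frame_seqr c1 c2 s s' : frame c2 s s' -> frame (Seq c1 c2) s s'.
Proof. by apply: frame_sub => x; rewrite /= mem_cat => ->; rewrite orbT. Qed.

Lemma exec_frame c s t s' : exec [::] c s t s' -> frame c s s'.
Proof.
elim=> {c s t s'}.
- by [].
- by move=> s x i e; split=> // y k; rewrite /= /upd inE => /negPf ->.
- by move=> s x i e; split=> // y k; rewrite /= /upd inE => /negPf ->.
- move=> c1 c2 s1 s2 s3 t1 t2 _ h1 _ h2; apply: (frame_trans (s2 := s2)).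
    exact: frame_seql.
  exact: frame_seqr.
- move=> e c1 c2 s s' t _; case: ifP => _.
    by apply: frame_sub => x; rewrite /= mem_cat => ->.
  by apply: frame_sub => x; rewrite /= mem_cat => ->; rewrite orbT.
- by [].
- by move=> e c s1 s2 s3 t1 t2 _ _ h1 _ h2; apply: frame_trans h1 h2.
(* With no procedures the body of every call is the default [Skip]. *)
- move=> f s s' t h _; case: f h => [|f] h; inversion h; exact: frame_refl.
Qed.

(** The continuation also receives the frame, so postconditions need to state only what has
    changed. *)
Lemma run_weaken c s K K' Q Q' : run c s K Q -> (K <= K')%N ->
  (forall s', frame c s s' -> Q s' -> Q' s') -> run c s K' Q'.
Proof.
move=> [t [s' [h tK q]]] KK' QQ'; exists t, s'.
split=> //; first exact: leq_trans tK KK'.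
by apply: QQ' q; apply: exec_frame h.
Qed.

Lemma run_seq c1 c2 s K1 K2 Q1 Q : run c1 s K1 Q1 ->
  (forall s', frame c1 s s' -> Q1 s' -> run c2 s' K2 Q) ->
  run (Seq c1 c2) s (K1 + K2) Q.
Proof.
move=> [t1 [s1 [h1 tK1 q1]]] /(_ s1 (exec_frame h1) q1) [t2 [s2 [h2 tK2 q2]]].
by exists (t1 + t2)%N, s2; split=> //; [apply: exec_Seq h1 h2|apply: leq_add].
Qed.

Lemma run_if e c1 c2 s K Q :
  run (if beval s e then c1 else c2) s K Q ->
  run (If e c1 c2) s (bcost e + K).+1 Q.
Proof.
move=> [t [s' [h tK q]]]; exists (bcost e + t).+1, s'.
by split=> //; [apply: exec_If|rewrite ltnS leq_add2l].
Qed.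

(* The first argument of [Inv] is a potential, which pays for the remaining
   iterations and so also gives termination. *)
Lemma run_while e c s (Inv : nat -> state R -> Prop) p :
  Inv p s ->
  (forall p' s', frame (While e c) s s' -> Inv p' s' -> beval s' e ->
    exists K, run c s' K
      (fun s'' => exists2 q, Inv q s'' & (K + (bcost e).+1 + q <= p')%N)) ->
  run (While e c) s (p + (bcost e).+1)
    (fun s' => ~~ beval s' e /\ exists q, Inv q s').
Proof.
move=> invp step.
suff : forall N s' p', (p' < N)%N -> frame (While e c) s s' -> Inv p' s' ->
  run (While e c) s' (p' + (bcost e).+1) (fun s'' => ~~ beval s'' e /\ exists q, Inv q s'').
  by move=> /(_ p.+1 s p (ltnSn _) (frame_refl _ _) invp).
elim=> // N IH s' p' p'N fr inv'.
case: (boolP (beval s' e)) => he; last first.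
  exists (bcost e).+1, s'; split; [exact: exec_WhileF|by rewrite leq_addl|].
  by split=> //; exists p'.
have [K [t [s1 [h1 tK [q invq le_q]]]]] := step _ _ fr inv' he.
have qN : (q < N)%N by lia.
have [t2 [s2 [h2 tK2 hQ]]] := IH s1 q qN (frame_trans fr (exec_frame h1)) invq.
exists (bcost e + t + t2).+1, s2; split=> //; last by lia.
exact: exec_WhileT he h1 h2.
Qed.

(** * Straight-line commands, run by symbolic evaluation *)

Fixpoint loopfree c : bool :=
  match c with
  | Skip | SetN _ _ _ | SetR _ _ _ => true
  | Seq c1 c2 | If _ c1 c2 => loopfree c1 && loopfree c2
  | While _ _ | Call _ => false
  end.

(** Both branches of a conditional are charged, which makes the bound independent of the state. The
    value 0 for loops and calls is a dummy, excluded by [loopfree]. *)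
Fixpoint scost c : nat :=
  match c with
  | Skip => 1
  | SetN _ i e => (ncost i + ncost e).+1
  | SetR _ i e => (ncost i + rcost e).+1
  | Seq c1 c2 => scost c1 + scost c2
  | If e c1 c2 => (bcost e + (scost c1 + scost c2)).+1
  | While _ _ | Call _ => 0
  end.

Definition setn s x i v : state R := State (upd (nmem s) x i v) (rmem s).
Definition setr s x i v : state R := State (nmem s) (upd (rmem s) x i v).

Fixpoint sexec c s : state R :=
  match c with
  | SetN x i e => setn s x (neval s i) (neval s e)
  | SetR x i e => setr s x (neval s i) (reval s e)
  | Seq c1 c2 => sexec c2 (sexec c1 s)
  | If e c1 c2 => if beval s e then sexec c1 s else sexec c2 s
  | _ => s
  end.

Lemma run_sexec c s Q : loopfree c -> Q (sexec c s) -> run c s (scost c) Q.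
Proof.
move=> lf q; suff [t h tK] : exists2 t, exec [::] c s t (sexec c s) & (t <= scost c)%N.
  by exists t, (sexec c s).
elim: c s lf {q} => //=.
- by move=> s _; exists 1%N => //; constructor.
- by move=> x i e s _; exists (ncost i + ncost e).+1 => //; constructor.
- by move=> x i e s _; exists (ncost i + rcost e).+1 => //; constructor.
- move=> c1 IH1 c2 IH2 s /andP[lf1 lf2].
  have [[t1 h1 l1] [t2 h2 l2]] := (IH1 s lf1, IH2 (sexec c1 s) lf2).
  by exists (t1 + t2)%N; [apply: exec_Seq h1 h2|apply: leq_add].
- move=> e c1 IH1 c2 IH2 s /andP[lf1 lf2].
  have [[t1 h1 l1] [t2 h2 l2]] := (IH1 s lf1, IH2 s lf2).
  exists (bcost e + (if beval s e then t1 else t2)).+1.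
    by apply: exec_If; case: ifP.
  by rewrite ltnS leq_add2l; case: ifP => _; lia.
Qed.

(** * Counted loops *)

Definition nv (x : nat) : nexp := NGet x (NConst 0).
Definition rv (x : nat) : rexp := RGet x (NConst 0).

Definition for_ (i : nat) (e0 : nexp) (e : bexp) c : cmd :=
  Seq (SetN i (NConst 0) e0)
      (While e (Seq c (SetN i (NConst 0) (NAdd (nv i) (NConst 1))))).

Definition forcost (e0 : nexp) (e : bexp) : nat := ncost e0 + bcost e + 10.

(** Iterations may have different costs [K k], because blocks have different sizes. The test is
    described by its value, since the sampling loop compares [4k + 3] rather than [k] with its
    bound. The stability hypothesis keeps the invariant independent of the counter, which the loop
    itself updates. *)
Lemma run_for i e0 e c s (Inv : nat -> state R -> Prop) (K : nat -> nat) n :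
  i \notin nmods c -> (neval s e0 <= n)%N ->
  (forall k s' v, Inv k s' -> Inv k (setn s' i 0 v)) ->
  Inv (neval s e0) s ->
  (forall k s', frame (for_ i e0 e c) s s' -> nmem s' i 0 = k -> (k <= n)%N ->
    beval s' e = (k < n)%N) ->
  (forall k s', frame (for_ i e0 e c) s s' -> nmem s' i 0 = k ->
    (neval s e0 <= k < n)%N -> Inv k s' -> run c s' (K k) (Inv k.+1)) ->
  run (for_ i e0 e c) s
    (\sum_(neval s e0 <= k < n) K k + (n - neval s e0).+1 * forcost e0 e)
    (fun s' => nmem s' i 0 = n /\ Inv n s').
Proof.
move=> ic le0 stab inv0 test body; set k0 := neval s e0 in le0 inv0 body *.
set fc := forcost e0 e.
apply: (@run_weaken _ _ ((ncost e0).+2 +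
    (\sum_(k0 <= k < n) (K k + fc) + (bcost e).+1)) _
    (fun s' => nmem s' i 0 = n /\ Inv n s')) => //; last first.
  rewrite big_split /= sum_nat_const_nat mulSn.
  have : fc = (ncost e0 + bcost e + 10)%N by [].
  by lia.
apply: (run_seq (Q1 := fun s' => Inv k0 s' /\ nmem s' i 0 = k0)).
  have [t h tK] : exists2 t, exec [::] (SetN i (NConst 0) e0) s t (setn s i 0 k0) & (t <= (ncost e0).+2)%N.
    by exists (ncost (NConst 0) + ncost e0).+1 => //; apply: exec_SetN.
  exists t, (setn s i 0 k0); split=> //; split; first exact: stab.
  by rewrite /= /upd !eqxx.
move=> s1 fr1 [inv1 i1].
have fr1' : frame (for_ i e0 e c) s s1 by apply: frame_seql.
pose J p s' := exists k, [/\ (k0 <= k <= n)%N, nmem s' i 0 = k, Inv k s' &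
  p = (\sum_(k <= j < n) (K j + fc))%N].
apply: (@run_weaken _ _ ((\sum_(k0 <= k < n) (K k + fc)) + (bcost e).+1) _
   (fun s' => ~~ beval s' e /\ exists q, J q s')); last first.
- move=> s2 fr2 [nb [q [k [/andP[kk kn] ik invk _]]]].
  have fr2' : frame (for_ i e0 e c) s s2.
    by apply: (frame_trans fr1'); apply: frame_seqr fr2.
  move: nb; rewrite (test _ _ fr2' ik kn) -leqNgt => nk.
  by have -> : n = k by lia.
- lia.
apply: run_while; first by exists k0; rewrite leqnn.
move=> p s2 fr2 [k [/andP[kk kn] ik invk ->]] be.
have fr2' : frame (for_ i e0 e c) s s2.
  by apply: (frame_trans fr1'); apply: frame_seqr fr2.
have ltkn : (k < n)%N by rewrite -(test _ _ fr2' ik kn).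
have hb := body k s2 fr2' ik; rewrite kk ltkn in hb.
exists (K k + 6)%N.
apply: (run_seq (hb isT invk)) => s3 fr3 inv3.
have i3 : nmem s3 i 0 = k by rewrite fr3.1.
have hs : run (SetN i (NConst 0) (NAdd (nv i) (NConst 1))) s3 6 (fun s' => s' = setn s3 i 0 k.+1).
  exists 6%N, (setn s3 i 0 k.+1); split=> //.
  have h := @exec_SetN R [::] s3 i (NConst 0) (NAdd (nv i) (NConst 1)).
  by rewrite [neval s3 (NAdd _ _)]/= i3 addn1 in h; exact: h.
apply: (run_weaken hs) => // s4 _ ->.
exists (\sum_(k.+1 <= j < n) (K j + fc))%N.
  exists k.+1; split=> //; [lia|by rewrite /= /upd !eqxx|exact: stab].
rewrite [X in (_ <= X)%N]big_ltn // /fc /forcost; lia.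
Qed.

Lemma run_for_const i e0 e c s (Inv : nat -> state R -> Prop) K n :
  i \notin nmods c -> (neval s e0 <= n)%N ->
  (forall k s' v, Inv k s' -> Inv k (setn s' i 0 v)) ->
  Inv (neval s e0) s ->
  (forall k s', frame (for_ i e0 e c) s s' -> nmem s' i 0 = k -> (k <= n)%N ->
    beval s' e = (k < n)%N) ->
  (forall k s', frame (for_ i e0 e c) s s' -> nmem s' i 0 = k ->
    (neval s e0 <= k < n)%N -> Inv k s' -> run c s' K (Inv k.+1)) ->
  run (for_ i e0 e c) s ((n - neval s e0).+1 * (K + forcost e0 e))
    (fun s' => nmem s' i 0 = n /\ Inv n s').
Proof.
move=> ic le0 stab inv0 test body.
apply: (run_weaken (run_for (K := fun=> K) ic le0 stab inv0 test body)) => //.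
by rewrite sum_nat_const_nat mulnDr leq_add2r leq_mul2r leqnSn orbT.
Qed.

End RunPredicate.

(** * Sorting a segment *)

(* A scalar variable is cell 0 of an array of its own; [v...] names arrays of
   natural numbers and [r...] arrays of reals.  Inputs, outputs and the two
   boundary solutions (9 and 10) are the real arrays below 11, so [x < 11]
   separates them from the working storage. *)
Notation vC := 5%N (only parsing).
Notation vN := 6%N (only parsing).
Notation vM := 7%N (only parsing).
Notation vQ := 8%N (only parsing).
Notation vST := 9%N (only parsing).
Notation vEN := 10%N (only parsing).
Notation vU := 11%N (only parsing).
Notation vV := 12%N (only parsing).
Notation vO := 13%N (only parsing).
Notation vK := 14%N (only parsing).
Notation vE := 15%N (only parsing).
Notation vJ := 16%N (only parsing).
Notation vPtr := 17%N (only parsing).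
Notation vI := 18%N (only parsing).

Notation rP := 11%N (only parsing).
Notation rS := 12%N (only parsing).
Notation rX := 13%N (only parsing).
Notation rPV := 14%N (only parsing).
Notation rA := 15%N (only parsing).
Notation rB := 16%N (only parsing).
Notation rC0 := 17%N (only parsing).
Notation rT := 18%N (only parsing).
Notation rPLO := 19%N (only parsing).
Notation rTMP := 21%N (only parsing).
Notation rLAM := 22%N (only parsing).

Definition ltN (e1 e2 : nexp) : bexp := BNot (BLeN e2 e1).
Definition ltR (e1 e2 : rexp) : bexp := BNot (BLeR e2 e1).

Lemma beval_ltN (R : realType) (s : state R) e1 e2 :
  beval s (ltN e1 e2) = (neval s e1 < neval s e2)%N.
Proof. by rewrite ltnNge. Qed.

Definition cnt (R : realType) (p : R -> bool) (X : nat -> R) (n : nat) : nat :=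
  \sum_(k < n) p (X k).

Lemma eq_cnt (R : realType) (p : R -> bool) (X Y : nat -> R) n :
  (forall k, (k < n)%N -> X k = Y k) -> cnt p X n = cnt p Y n.
Proof. by move=> h; apply: eq_bigr => k _; rewrite h. Qed.

Lemma cnt_swap (R : realType) (p : R -> bool) (X Y : nat -> R) i j n :
  (i < n)%N -> (j < n)%N -> i != j -> Y i = X j -> Y j = X i ->
  (forall k, k != i -> k != j -> Y k = X k) -> cnt p Y n = cnt p X n.
Proof.
move=> ltin ltjn nij Yi Yj Yk; rewrite /cnt.
rewrite (bigD1 (Ordinal ltin)) //= (bigD1 (Ordinal ltjn)) /=; last by rewrite eq_sym.
rewrite [RHS](bigD1 (Ordinal ltin)) //= [X in _ = (_ + X)%N](bigD1 (Ordinal ltjn)) /=; last by rewrite eq_sym.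
rewrite Yi Yj addnCA; do 2 congr (_ + _)%N.
by apply: eq_bigr => k /andP[ki kj]; rewrite Yk.
Qed.

Definition sort_step : cmd :=
  If (ltR (RGet rX (nv vV)) (RGet rX (nv vU)))
    (Seq (SetR rTMP (NConst 0) (RGet rX (nv vU)))
    (Seq (SetR rX (nv vU) (RGet rX (nv vV)))
         (SetR rX (nv vV) (rv rTMP)))) Skip.

Definition sort_inner : cmd :=
  for_ vV (NAdd (nv vU) (NConst 1)) (ltN (nv vV) (nv vEN)) sort_step.

Definition sort_cmd : cmd :=
  for_ vU (nv vST) (ltN (nv vU) (nv vEN)) sort_inner.

(** That cells are only permuted is recorded as equality of all counts on every prefix containing
    the segment; rank estimates need just this. The cells of the segment before [u] are final, each
    being at most everything after it. *)
Definition sorting (R : realType) (st u en : nat) (X0 X : nat -> R) : Prop :=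
  [/\ forall k, (k < st)%N || (en <= k)%N -> X k = X0 k,
      forall i j, (st <= i < u)%N -> (i < j < en)%N -> X i <= X j &
      forall p n, (en <= n)%N -> cnt p X n = cnt p X0 n].

(** Exchange sort: a later cell that is smaller is swapped in, so cell [u] always carries the
    minimum of itself and the cells compared so far. *)
Lemma run_sort_inner (R : realType) (s : state R) X0 st u en :
  nmem s vST 0 = st -> nmem s vEN 0 = en -> nmem s vU 0 = u -> (st <= u < en)%N ->
  sorting st u en X0 (rmem s rX) ->
  run sort_inner s ((en - u) * (scost sort_step + forcost (NAdd (nv vU) (NConst 1)) (ltN (nv vV) (nv vEN))))
    (fun s' => sorting st u.+1 en X0 (rmem s' rX)).
Proof.
move=> sST sEN sU stu hs.
have eu : neval s (NAdd (nv vU) (NConst 1)) = u.+1 by rewrite /= sU addn1.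
have -> : (en - u = (en - neval s (NAdd (nv vU) (NConst 1))).+1)%N by rewrite eu; lia.
pose Inv k s' := sorting st u en X0 (rmem s' rX) /\
  forall j, (u < j < k)%N -> rmem s' rX u <= rmem s' rX j.
apply: (@run_weaken _ _ _ _ _ (fun s' => nmem s' vV 0 = en /\ Inv en s')); last first.
- move=> s' _ [_ [[h1 h2 h3] h4]]; split=> // i j /andP[sti].
  rewrite ltnS leq_eqVlt => /orP[/eqP ->|iu] hj; first exact: h4.
  by apply: h2; rewrite ?sti.
- exact: leqnn.
apply: (run_for_const (Inv := Inv)) => //.
- by rewrite eu; lia.
- by rewrite eu; split=> // j; lia.
- by move=> k s' fr ik _; rewrite beval_ltN /= ik fr.1 ?sEN.
move=> k s' fr ik; rewrite eu => /andP[uk ken] [[h1 h2 h3] h4].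
apply: run_sexec => //=.
have sU' : nmem s' vU 0 = u by rewrite fr.1.
rewrite -ltNge ik sU' /upd /=.
case: ltP => hlt; last first.
  split; first by split.
  move=> j; rewrite ltnS andbC leq_eqVlt => /andP[/orP[/eqP -> //|jk] uj].
  by apply: h4; rewrite uj.
rewrite /Inv /sorting /= /upd /= ?eqxx.
have nku : (k == u) = false by lia.
split.
  split.
  - move=> i hi; case: eqP => [?|_]; first lia.
    by case: eqP => [?|_]; [lia|apply: h1].
  - move=> i j hi hj; have -> : (i == k) = false by lia.
    have -> : (i == u) = false by lia.
    case: eqP => [?|_]; first by apply: h2; lia.
    by case: eqP => [?|_]; apply: h2; lia.
  - move=> p n hn; rewrite -h3 //; apply: (@cnt_swap _ _ _ _ u k); rewrite ?eqxx ?(eq_sym u) ?nku //; try lia.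
    by move=> i /negPf -> /negPf ->.
move=> j /andP[uj jk]; rewrite (eq_sym u) nku ?eqxx.
case: eqP => [_|nj]; first exact: ltW.
have -> : (j == u) = false by lia.
by apply: le_trans (ltW hlt) (h4 _ _); lia.
Qed.

Lemma run_sort : exists C, forall (R : realType) (s : state R),
  (nmem s vST 0 <= nmem s vEN 0)%N ->
  run sort_cmd s (C * (nmem s vEN 0 - nmem s vST 0).+1 ^ 2)%N
    (fun s' => sorting (nmem s vST 0) (nmem s vEN 0) (nmem s vEN 0) (rmem s rX) (rmem s' rX)).
Proof.
set C1 := (scost sort_step + forcost (NAdd (nv vU) (NConst 1)) (ltN (nv vV) (nv vEN)))%N.
set C2 := (forcost (nv vST) (ltN (nv vU) (nv vEN)))%N.
exists (C1 + C2)%N => R s; set st := nmem s vST 0; set en := nmem s vEN 0 => le.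
apply: (@run_weaken _ _ _ ((en - st).+1 * ((en - st) * C1 + C2)) _
  (fun s' => nmem s' vU 0 = en /\ sorting st en en (rmem s rX) (rmem s' rX))) => [||? _ []//]; last first.
  by rewrite -mulnn mulnCA leq_mul2l /=; move: (en - st)%N => d; nia.
apply: (@run_for_const _ _ _ _ _ _ (fun u s' => sorting st u en (rmem s rX) (rmem s' rX))) => //.
- by split=> // i j; rewrite /= -/st; lia.
- by move=> k s' fr ik _; rewrite beval_ltN /= ik fr.1.
move=> u s' fr iu /= /andP[stu uen] hs.
apply: (run_weaken (run_sort_inner (st := st) (en := en) (u := u) _ _ _ _ hs)) => //.
- by rewrite fr.1.
- by rewrite fr.1.
- by rewrite stu.
- by rewrite leq_mul2r; apply/orP; right; rewrite leq_sub2l.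
Qed.

(** * Approximate medians in linear time *)

Section Sampling.
Variables (R : realType) (p : R -> bool).
Implicit Types X : nat -> R.

Lemma cntD X m n :
  cnt p X (m + n) = (cnt p X m + cnt p (fun k => X (m + k)%N) n)%N.
Proof. by rewrite /cnt big_split_ord. Qed.

Lemma cnt1 X : cnt p X 1 = p (X 0).
Proof. by rewrite /cnt big_ord_recl big_ord0 addn0. Qed.

Lemma cnt4 X : cnt p X 4 = (p (X 0) + p (X 1) + p (X 2) + p (X 3))%N.
Proof. by rewrite /cnt !big_ord_recr big_ord0. Qed.

Lemma leq_cnt X m n : (m <= n)%N -> (cnt p X m <= cnt p X n)%N.
Proof. by move=> mn; rewrite -(subnKC mn) cntD leq_addr. Qed.

Lemma cnt_all X n : (forall k, (k < n)%N -> p (X k)) -> cnt p X n = n.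
Proof.
move=> h; rewrite /cnt (eq_bigr (fun=> 1%N)) => [|k _]; last by rewrite h.
by rewrite sum1_card card_ord.
Qed.

(* Counts below a threshold never grow under sampling (the sample is the largest
   of its four neighbours); counts above it lose up to 3 per sorted block, the
   elements of the quadruple where the threshold falls. *)
Lemma sample_up1 Y h :
  (forall i j, (i < j < 4 * h)%N -> (p (Y i) <= p (Y j))%N) ->
  (4 * cnt p (fun k => Y (4 * k + 3)%N) h <= cnt p Y (4 * h) + 3)%N.
Proof.
case: h => [|h] sY; first by rewrite /cnt big_ord0.
(* The slack 3 arises at most once. Charging it to the last sampled cell makes the claim inductive:
   once [p] holds there, it holds on all later cells, and these contribute equally to both sides. *)
suff : (4 * cnt p (fun k => Y (4 * k + 3)%N) h.+1 <=
        cnt p Y (4 * h.+1) + 3 * p (Y (4 * h + 3)%N))%N.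
  by case: (p (Y _)); lia.
elim: h sY => [|h IH] sY.
  by rewrite muln1 cnt4 cnt1 muln0 add0n; lia.
rewrite -(addn1 h.+1) cntD cnt1 addn0 !mulnDr cntD muln1 cnt4.
have := IH (fun i j ij => sY i j ltac:(lia)).
have := sY (4 * h + 3)%N (4 * h.+1 + 0)%N ltac:(lia).
have := sY (4 * h + 3)%N (4 * h.+1 + 1)%N ltac:(lia).
have := sY (4 * h + 3)%N (4 * h.+1 + 2)%N ltac:(lia).
have := sY (4 * h + 3)%N (4 * h.+1 + 3)%N ltac:(lia).
lia.
Qed.

Lemma sample_down1 Y h :
  (forall i j, (i < j < 4 * h)%N -> (p (Y j) <= p (Y i))%N) ->
  (4 * cnt p (fun k => Y (4 * k + 3)%N) h <= cnt p Y (4 * h))%N.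
Proof.
elim: h => [|h IH] sY; first by rewrite /cnt big_ord0.
rewrite -(addn1 h) cntD cnt1 addn0 !mulnDr cntD muln1 cnt4.
have := IH (fun i j ij => sY i j ltac:(lia)).
have := sY (4 * h + 0)%N (4 * h + 3)%N ltac:(lia).
have := sY (4 * h + 1)%N (4 * h + 3)%N ltac:(lia).
have := sY (4 * h + 2)%N (4 * h + 3)%N ltac:(lia).
rewrite /=; lia.
Qed.

Definition block_sorted (h c : nat) X : Prop :=
  forall d i j, (d < c)%N -> (i < j < h)%N -> X (d * h + i)%N <= X (d * h + j)%N.

Lemma block_sortedW h c X : block_sorted h c.+1 X -> block_sorted h c X.
Proof. by move=> sX d i j dc; apply: sX; apply: ltnW. Qed.

Lemma cnt_sampleS X h c :
  cnt p (fun k => X (4 * k + 3)%N) (c.+1 * h) =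
  (cnt p (fun k => X (4 * k + 3)%N) (c * h) +
   cnt p (fun k => X (c * (4 * h) + (4 * k + 3))%N) h)%N.
Proof.
by rewrite (mulSnr c) cntD; congr (_ + _)%N; apply: eq_cnt => k _; congr X; lia.
Qed.

Lemma sample_up X h c : (forall x y, x <= y -> p x -> p y) ->
  block_sorted (4 * h) c X ->
  (4 * cnt p (fun k => X (4 * k + 3)%N) (c * h) <= cnt p X (c * (4 * h)) + 3 * c)%N.
Proof.
move=> pup; elim: c => [|c IH] sX; first by rewrite !mul0n /cnt big_ord0.
rewrite cnt_sampleS (mulSnr c) cntD; have IHc := IH (block_sortedW sX).
have h1 : (4 * cnt p (fun k => X (c * (4 * h) + (4 * k + 3))%N) h <=
    cnt p (fun k => X (c * (4 * h) + k)%N) (4 * h) + 3)%N.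
  apply: (@sample_up1 (fun k => X (c * (4 * h) + k)%N)) => i j ij.
  by have /pup := sX c i j (ltnSn c) ij; case: (p (X _)) => // ->.
by lia.
Qed.

Lemma sample_down X h c : (forall x y, x <= y -> p y -> p x) ->
  block_sorted (4 * h) c X ->
  (4 * cnt p (fun k => X (4 * k + 3)%N) (c * h) <= cnt p X (c * (4 * h)))%N.
Proof.
move=> pdn; elim: c => [|c IH] sX; first by rewrite !mul0n /cnt big_ord0.
rewrite cnt_sampleS (mulSnr c) cntD mulnDr; apply: leq_add.
  exact: IH (block_sortedW sX).
apply: (@sample_down1 (fun k => X (c * (4 * h) + k)%N)) => i j ij.
by have /pdn := sX c i j (ltnSn c) ij; case: (p (X (_ + j)%N)) => // ->.
Qed.

End Sampling.

(** Index expressions have no multiplication; a multiple by a fixed [k] is unfolded into additions,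
    at a cost that is constant. *)
Fixpoint nmul (k : nat) (e : nexp) : nexp :=
  if k is k'.+1 then NAdd e (nmul k' e) else NConst 0.

Lemma neval_nmul (R : realType) (s : state R) k e :
  neval s (nmul k e) = (k * neval s e)%N.
Proof. by elim: k => // k IH; rewrite mulSn -IH. Qed.

Definition assign (x : nat) (e : nexp) : cmd := SetN x (NConst 0) e.

Definition block_step : cmd :=
  Seq (assign vEN (NAdd (nv vST) (nmul 8 (nv vQ))))
  (Seq sort_cmd (assign vST (nv vEN))).

Definition sort_blocks : cmd :=
  Seq (assign vST (NConst 0)) (While (ltN (nv vST) (nv vM)) block_step).

Lemma run_block_step : exists C, forall (R : realType) (s : state R) (b : nat),
  b = (8 * nmem s vQ 0)%N ->
  run block_step s (C * b.+1 ^ 2)%N (fun s' => nmem s' vST 0 = (nmem s vST 0 + b)%N /\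
    sorting (nmem s vST 0) (nmem s vST 0 + b) (nmem s vST 0 + b) (rmem s rX) (rmem s' rX)).
Proof.
have [C hC] := run_sort.
set c1 := assign vEN (NAdd (nv vST) (nmul 8 (nv vQ))); set c2 := assign vST (nv vEN).
exists (scost c1 + (C + scost c2))%N => R s b ->.
set q := nmem s vQ 0; set st := nmem s vST 0.
apply: (@run_weaken _ _ _ (scost c1 + (C * (8 * q).+1 ^ 2 + scost c2)) _ (fun s' => nmem s' vST 0 = (st + 8 * q)%N /\
    sorting st (st + 8 * q) (st + 8 * q) (rmem s rX) (rmem s' rX))) => //; last first.
  by rewrite -mulnn; nia.
have h1 : run c1 s (scost c1) (fun s1 => s1 = setn s vEN 0 (st + 8 * q)).
  by apply: run_sexec => //; rewrite [sexec _ _]/= neval_nmul.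
apply: (run_seq h1) => s1 _ ->.
have := hC R (setn s vEN 0 (st + 8 * q)); rewrite /= /upd /= -/st addKn => /(_ (leq_addr _ _)) h2.
apply: (run_seq h2) => s2 fr2 hs.
apply: run_sexec => //; split; last exact: hs.
by rewrite /= /upd /= fr2.1.
Qed.

Lemma run_sort_blocks : exists C, forall (R : realType) (s : state R) (c q : nat),
  (0 < q)%N -> nmem s vQ 0 = q -> nmem s vM 0 = (c * (8 * q))%N ->
  run sort_blocks s (C * (c.+1 * q ^ 2))%N (fun s' =>
    block_sorted (8 * q) c (rmem s' rX) /\
    forall p n, (c * (8 * q) <= n)%N -> cnt p (rmem s' rX) n = cnt p (rmem s rX) n).
Proof.
have [C hC] := run_block_step.
set e := ltN (nv vST) (nv vM).
exists (81 * C + (bcost e).+1 + 3)%N => R s c q q0 sQ sM.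
set b := (8 * q)%N in sM *.
pose Kb := (C * b.+1 ^ 2 + (bcost e).+1)%N.
pose Inv p s' := exists d, [/\ (d <= c)%N, nmem s' vST 0 = (d * b)%N,
  block_sorted b d (rmem s' rX),
  forall P n, (c * b <= n)%N -> cnt P (rmem s' rX) n = cnt P (rmem s rX) n &
  p = ((c - d) * Kb)%N].
apply: (@run_weaken _ _ _ (3 + (c * Kb + (bcost e).+1))%N _
   (fun s' => ~~ beval s' e /\ exists p, Inv p s')); last first.
- move=> s' fr [nb [p [d [dc dst dsort dcnt _]]]]; split=> //.
  move: nb; rewrite beval_ltN /= dst fr.1 // sM -leqNgt => le.
  by have -> : c = d by move: le; rewrite leq_pmul2r /b; lia.
- have -> : (c * Kb = C * (c * b.+1 ^ 2) + c * (bcost e).+1)%N by rewrite /Kb; lia.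
  (* [8q + 1 <= 9q] because [q] is positive. *)
  have bq : (b.+1 ^ 2 <= 81 * q ^ 2)%N.
    by rewrite (_ : 81 = 9 ^ 2)%N // -expnMn leq_exp2r // /b; lia.
  have : (C * (c * b.+1 ^ 2) <= C * (c * (81 * q ^ 2)))%N by rewrite !leq_mul2l bq !orbT.
  have q1 : (0 < q ^ 2)%N by rewrite expn_gt0 q0.
  move: (q ^ 2)%N (bcost e) q1 => z w z1 h; apply: (leq_trans (n := 3 + (C * (c * (81 * z)) + c * w.+1 + w.+1))%N); first by lia.
  nia.
have h1 : run (assign vST (NConst 0)) s 3 (fun s1 => s1 = setn s vST 0 0).
  exact: (run_sexec (c := assign vST (NConst 0))).
apply: (run_seq h1) => s1 _ ->.
apply: run_while.
  by exists 0%N; split=> //; rewrite subn0.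
move=> p s2 fr2 [d [dc dst dsort dcnt ->]]; rewrite beval_ltN /= dst fr2.1 //= /upd /= sM => ltdb.
have ltdc : (d < c)%N by move: ltdb; rewrite ltn_pmul2r /b; lia.
exists (C * b.+1 ^ 2)%N.
have eb : b = (8 * nmem s2 vQ 0)%N by rewrite fr2.1 //= /upd /= sQ.
apply: (run_weaken (hC _ s2 b eb)) => // s3 fr3 []; rewrite dst => st3 [so1 so2 so3].
exists ((c - d.+1) * Kb)%N; last by rewrite -/e -/Kb -mulSn subnSK.
exists d.+1; split=> //; first by rewrite st3; lia.
  move=> d' i j; rewrite ltnS leq_eqVlt => /orP[/eqP -> ij|d'd ij].
    by apply: so2; lia.
  have db : (d' * b + b <= d * b)%N by rewrite -mulSnr leq_mul2r d'd orbT.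
  by rewrite !so1; [exact: dsort|lia|lia].
by move=> P n cn; rewrite so3 ?dcnt //; nia.
Qed.

Definition sample_step : cmd :=
  SetR rX (nv vO) (RGet rX (NAdd (nmul 4 (nv vO)) (NConst 3))).

Definition sample_test : bexp := ltN (NAdd (nmul 4 (nv vO)) (NConst 3)) (nv vM).

Definition sample_cmd : cmd :=
  Seq (for_ vO (NConst 0) sample_test sample_step) (assign vM (nv vO)).

Lemma run_sample : exists C, forall (R : realType) (s : state R) (m : nat),
  nmem s vM 0 = (4 * m)%N ->
  run sample_cmd s (C * m.+1)%N (fun s' => nmem s' vM 0 = m /\
    forall k, (k < m)%N -> rmem s' rX k = rmem s rX (4 * k + 3)%N).
Proof.
exists (scost sample_step + forcost (NConst 0) sample_test + scost (assign vM (nv vO)))%N => R s m sM.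
(* Sampling in place is safe: step [k] reads cell [4k + 3], which lies beyond all cells written so
   far. *)
pose Inv k (s' : state R) := forall j, rmem s' rX j = rmem s rX (if (j < k)%N then (4 * j + 3)%N else j).
have hfor : run (for_ vO (NConst 0) sample_test sample_step) s
  ((m - 0).+1 * (scost sample_step + forcost (NConst 0) sample_test))
  (fun s' => nmem s' vO 0 = m /\ Inv m s').
  apply: (run_for_const (Inv := Inv) (n := m)) => //.
    by move=> k s' fr ik km; rewrite beval_ltN /= ik fr.1 // sM; apply/idP/idP; lia.
  move=> k s' fr ik km inv; apply: run_sexec => // j /=.
  rewrite ik /upd /=; case: eqP => [->|/eqP jk].
    by rewrite inv ltnSn ifF; [congr (rmem s _ _)|]; lia.
  by rewrite inv ltnS [in RHS]leq_eqVlt (negPf jk).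
apply: (run_weaken (run_seq (Q := fun s' => nmem s' vM 0 = m /\
    forall k, (k < m)%N -> rmem s' rX k = rmem s rX (4 * k + 3)%N) hfor _)) => //.
  move=> s1 fr1 [o1 inv1]; apply: run_sexec => //=.
  by split=> // k km; rewrite inv1 km.
by rewrite /= subn0; nia.
Qed.

Definition level_cmd : cmd :=
  Seq sort_blocks (Seq sample_cmd (assign vQ (NAdd (nv vQ) (nv vQ)))).

(** The output has [c * 2q] cells, that is [c / 8] blocks for the doubled [q], so [c * q ^ 2] halves
    at the next level. The error [3 * c] is the loss of 3 per sorted block. *)
Lemma run_level : exists C, forall (R : realType) (s : state R) (c q : nat),
  (0 < q)%N -> nmem s vQ 0 = q -> nmem s vM 0 = (c * (8 * q))%N ->
  run level_cmd s (C * (c.+1 * q ^ 2))%N (fun s' =>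
    [/\ nmem s' vQ 0 = (2 * q)%N, nmem s' vM 0 = (c * (2 * q))%N,
     forall p : R -> bool, (forall x y, x <= y -> p y -> p x) ->
       (4 * cnt p (rmem s' rX) (c * (2 * q)) <= cnt p (rmem s rX) (c * (8 * q)))%N &
     forall p : R -> bool, (forall x y, x <= y -> p x -> p y) ->
       (4 * cnt p (rmem s' rX) (c * (2 * q)) <= cnt p (rmem s rX) (c * (8 * q)) + 3 * c)%N]).
Proof.
have [[C1 hC1] [C2 hC2]] := (run_sort_blocks, run_sample).
set c3 := assign vQ (NAdd (nv vQ) (nv vQ)).
exists (C1 + C2 * 3 + scost c3)%N => R s c q q0 sQ sM.
apply: (@run_weaken _ _ _ (C1 * (c.+1 * q ^ 2) + (C2 * (c * (2 * q)).+1 + scost c3)) _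
  (fun s' => [/\ nmem s' vQ 0 = (2 * q)%N, nmem s' vM 0 = (c * (2 * q))%N &
    exists X, [/\ block_sorted (8 * q) c X,
      forall p n, (c * (8 * q) <= n)%N -> cnt p X n = cnt p (rmem s rX) n &
      forall k, (k < c * (2 * q))%N -> rmem s' rX k = X (4 * k + 3)%N]])); last first.
- move=> s' _ [sQ' sM' [X [Xs Xc XX]]].
  have e8 : (8 * q = 4 * (2 * q))%N by rewrite mulnA.
  rewrite e8 in Xs Xc *; split=> // p hp; rewrite (eq_cnt _ XX) -Xc //.
    exact: sample_down.
  exact: sample_up.
- have qq : (q <= q ^ 2)%N by rewrite -mulnn leq_pmulr.
  have h1 : ((c * (2 * q)).+1 <= 3 * (c.+1 * q ^ 2))%N by nia.
  have h2 : (1 <= c.+1 * q ^ 2)%N by nia.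
  rewrite !mulnDl -!addnA leq_add2l -mulnA leq_add ?leq_mul2l ?h1 ?orbT //.
  by rewrite leq_pmulr.
apply: (run_seq (hC1 R s c q q0 sQ sM)) => s1 fr1 [so1 cn1].
have sM1 : nmem s1 vM 0 = (4 * (c * (2 * q)))%N by rewrite fr1.1 // sM; lia.
apply: (run_seq (hC2 R s1 _ sM1)) => s2 fr2 [sM2 X2].
apply: run_sexec => //; split=> /=.
- by rewrite /upd /= fr2.1 // fr1.1 // sQ; lia.
- exact: sM2.
- by exists (rmem s1 rX).
Qed.

(** * Choice of the pivot *)

Definition grow_cmd : cmd :=
  Seq (assign vM (NConst 1))
      (While (BLeN (nmul 8 (nv vM)) (nv vN)) (assign vM (nmul 8 (nv vM)))).

(** Sampling is confined to a prefix whose length is a power of 8, so that all levels divide evenly.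
    The potential [n - 8 ^ T] overestimates the logarithmic number of rounds but stays within the
    linear budget. *)
Lemma run_grow : exists C, forall (R : realType) (s : state R),
  (0 < nmem s vN 0)%N ->
  run grow_cmd s (C * nmem s vN 0)%N (fun s' => exists T,
    nmem s' vM 0 = (8 ^ T)%N /\ (8 ^ T <= nmem s vN 0 < 8 * 8 ^ T)%N).
Proof.
set e := BLeN (nmul 8 (nv vM)) (nv vN); set b := assign vM (nmul 8 (nv vM)).
exists (3 + (scost b + (bcost e).+1) + (bcost e).+1)%N => R s; set n := nmem s vN 0 => n0.
pose Inv p (s' : state R) := exists T, [/\ nmem s' vM 0 = (8 ^ T)%N, (8 ^ T <= n)%N &
  p = ((n - 8 ^ T) * (scost b + (bcost e).+1))%N].
apply: (@run_weaken _ _ _ (3 + ((n - 1) * (scost b + (bcost e).+1) + (bcost e).+1)) _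
  (fun s' => ~~ beval s' e /\ exists p, Inv p s')); last first.
- move=> s' fr [nb [p [T [sM Tn _]]]]; exists T; split=> //; rewrite Tn.
  by move: nb; rewrite /= sM -!ltnNge fr.1 // -/n; lia.
- by move: (bcost e) (scost b) => w z; nia.
have h1 : run (assign vM (NConst 1)) s 3 (fun s1 => s1 = setn s vM 0 1).
  exact: (run_sexec (c := assign vM (NConst 1))).
apply: (run_seq h1) => s1 _ ->.
apply: run_while; first by exists 0%N.
move=> p s2 fr2 [T [sM Tn ->]] be.
have sN : nmem s2 vN 0 = n by rewrite fr2.1.
have le8 : (8 * 8 ^ T <= n)%N by move: be; rewrite /= sM sN; lia.
exists (scost b); apply: run_sexec => //.
exists ((n - 8 ^ T.+1) * (scost b + (bcost e).+1))%N.
  by exists T.+1; split; rewrite ?expnS //= /upd /= sM; lia.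
rewrite -mulSn leq_mul2r; apply/orP; right.
have : (0 < 8 ^ T)%N by rewrite expn_gt0.
by rewrite expnS; lia.
Qed.

(** Sorting and sampling destroy their array, while the breakpoints are still needed for pruning. *)
Definition copy_cmd : cmd :=
  for_ vK (NConst 0) (ltN (nv vK) (nv vM)) (SetR rX (nv vK) (RGet rP (nv vK))).

Lemma run_copy : exists C, forall (R : realType) (s : state R),
  run copy_cmd s (C * (nmem s vM 0).+1)%N (fun s' =>
    forall k, (k < nmem s vM 0)%N -> rmem s' rX k = rmem s rP k).
Proof.
set b := SetR rX (nv vK) (RGet rP (nv vK)); set e := ltN (nv vK) (nv vM).
exists (scost b + forcost (NConst 0) e)%N => R s; set n := nmem s vM 0.
pose Inv k (s' : state R) := forall j, (j < k)%N -> rmem s' rX j = rmem s rP j.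
apply: (@run_weaken _ _ _ ((n - 0).+1 * (scost b + forcost (NConst 0) e)) _
  (fun s' => nmem s' vK 0 = n /\ Inv n s')); last by move=> s' _ [].
  apply: (run_for_const (Inv := Inv) (n := n)) => //.
    by move=> k s' fr ik _; rewrite beval_ltN /= ik fr.1.
  move=> k s' fr ik kn inv; apply: run_sexec => // j jk.
  rewrite /= /upd ik /=; case: eqP => [->|nj]; first by rewrite fr.2.
  by apply: inv; lia.
by rewrite subn0 mulnC.
Qed.

Lemma cnt_le_sorted (R : realType) (X : nat -> R) n i : (i < n)%N ->
  (forall j k, (j < k < n)%N -> X j <= X k) -> (i < cnt (fun x => (x <= X i)%R) X n)%N.
Proof.
move=> ltin sX; have := leq_cnt (fun x => x <= X i) X ltin.
rewrite {1}cnt_all // => k; rewrite ltnS leq_eqVlt => /orP[/eqP -> //|ki].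
by apply: sX; rewrite ki.
Qed.

Lemma cnt_ge_sorted (R : realType) (X : nat -> R) n i : (i < n)%N ->
  (forall j k, (j < k < n)%N -> X j <= X k) -> (n - i <= cnt (fun x => (X i <= x)%R) X n)%N.
Proof.
move=> ltin sX; rewrite -{2}(subnKC (ltnW ltin)) cntD.
apply: leq_trans (leq_addl _ _); rewrite cnt_all // => k ki.
case: k ki => [|k] ki; first by rewrite addn0.
by apply: sX; lia.
Qed.

Definition down_closed (R : realType) (p : R -> bool) := forall x y, x <= y -> p y -> p x.
Definition up_closed (R : realType) (p : R -> bool) := forall x y, x <= y -> p x -> p y.

(* When [vM = vQ = 1] the truncated subtraction [vM - 7 vQ] is 0; otherwise
   [vM = 8 vQ] at the end and the index is [vQ]. *)
Definition pivot_cmd : cmd :=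
  Seq grow_cmd (Seq copy_cmd (Seq (assign vQ (NConst 1))
  (Seq (While (ltN (nmul 8 (nv vQ)) (nv vM)) level_cmd)
  (Seq (assign vST (NConst 0)) (Seq (assign vEN (nv vM)) (Seq sort_cmd
  (SetR rPV (NConst 0) (RGet rX (NSub (nv vM) (nmul 7 (nv vQ))))))))))).

(* After [t] levels the array holds [8 ^ r * 2 ^ t] samples of the first [8 ^ T]
   cells of [P].  The level at [t] has [8 ^ r.-1] blocks, so it loses
   [3 * 4 ^ t * 8 ^ r.-1] cells above a threshold; this halves from one level to
   the next, and the term [6 * 4 ^ t * 8 ^ r] (scaled by 8) pays for all the
   remaining levels. *)
Definition reduced (R : realType) (P : nat -> R) (T t r : nat) (X : nat -> R) : Prop :=
  [/\ (t + r)%N = T, (0 < r)%N || (T == 0)%N,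
   forall p, down_closed p -> (4 ^ t * cnt p X (8 ^ r * 2 ^ t) <= cnt p P (8 ^ T))%N &
   forall p, up_closed p ->
    (8 * 4 ^ t * cnt p X (8 ^ r * 2 ^ t) + 6 * 4 ^ t * 8 ^ r <=
     8 * cnt p P (8 ^ T) + 6 * 8 ^ T)%N].

(** For [r = 1] the pivot has index [2 ^ t] among [8 * 2 ^ t] sorted cells. The asymmetric choice
    compensates the one-sided error: the lower eighth carries over without loss, and of the upper
    seven eighths the error consumes at most six. For [r = 0] there is a single cell. *)
Lemma reduced_pivot (R : realType) (P X : nat -> R) T t r v :
  (r <= 1)%N -> reduced P T t r X ->
  (forall j k, (j < k < 8 ^ r * 2 ^ t)%N -> X j <= X k) ->
  v = X (8 ^ r * 2 ^ t - 7 * 2 ^ t)%N ->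
  (8 ^ T <= 8 * cnt (fun x => (x <= v)%R) P (8 ^ T))%N /\
  (8 ^ T <= 8 * cnt (fun x => (v <= x)%R) P (8 ^ T))%N.
Proof.
move=> r1 [etr r0 hd hu] sX ev.
have e8 : (8 ^ t = 4 ^ t * 2 ^ t)%N by rewrite -expnMn.
have t0 : (0 < 2 ^ t)%N by rewrite expn_gt0.
have ltiN : (8 ^ r * 2 ^ t - 7 * 2 ^ t < 8 ^ r * 2 ^ t)%N.
  by rewrite ltn_subrL !muln_gt0 t0 expn_gt0.
have := hd _ (fun x y (xy : x <= y) (yv : y <= v) => le_trans xy yv).
have := hu _ (fun x y (xy : x <= y) (vx : v <= x) => le_trans vx xy).
have := cnt_le_sorted ltiN sX; have := cnt_ge_sorted ltiN sX; rewrite -ev.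
move: (cnt _ X _) (cnt _ X _) (cnt _ P _) (cnt _ P _) => g l cg cl {hd hu sX ev}.
case: r r1 etr r0 ltiN => [|[|//]] _ <- //=.
  by rewrite addn0 => /eqP -> _; rewrite !expn0; lia.
move=> _ _; rewrite addn1 !expnS expn0 e8.
move: (4 ^ t)%N (2 ^ t)%N => x y hg hl ug dl; split; nia.
Qed.

(** The credit falls from [6 * 4 ^ t * 8 ^ r.+2] to [6 * 4 ^ t.+1 * 8 ^ r.+1], that is by
    [24 * 4 ^ t * 8 ^ r.+1]. This is exactly the new loss [3 * 8 ^ r.+1] weighted by [8 * 4 ^ t]. *)
Lemma reduced_step (R : realType) (P X X' : nat -> R) T t r :
  (forall p : R -> bool, down_closed p ->
       (4 * cnt p X' (8 ^ r.+1 * 2 ^ t.+1) <= cnt p X (8 ^ r.+2 * 2 ^ t))%N) ->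
  (forall p : R -> bool, up_closed p ->
       (4 * cnt p X' (8 ^ r.+1 * 2 ^ t.+1) <= cnt p X (8 ^ r.+2 * 2 ^ t) + 3 * 8 ^ r.+1)%N) ->
  reduced P T t r.+2 X -> reduced P T t.+1 r.+1 X'.
Proof.
move=> hd hu [etr r0 d u]; split=> //; first by rewrite -etr addSnnS.
  move=> p pd; apply: leq_trans (d p pd).
  by rewrite expnSr -mulnA leq_mul2l hd ?orbT.
move=> p pu; apply: leq_trans (u p pu).
have := hu p pu; rewrite (expnS 4) (expnS 8 r.+1).
move: (8 ^ r.+1)%N (4 ^ t)%N (cnt p X _) (cnt p X' _) => z w y x h.
have : (w * (4 * x) <= w * (y + 3 * z))%N by rewrite leq_mul2l h orbT.
by nia.
Qed.

(** The potential [8 ^ r * 4 ^ t] starts at [8 ^ T] and halves at each level, and the released half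
    pays for the level. *)
Lemma run_reduce : exists C, forall (R : realType) (s : state R) (P : nat -> R) T,
  nmem s vM 0 = (8 ^ T)%N -> nmem s vQ 0 = 1%N ->
  (forall k, (k < 8 ^ T)%N -> rmem s rX k = P k) ->
  run (While (ltN (nmul 8 (nv vQ)) (nv vM)) level_cmd) s (C * 8 ^ T)%N
    (fun s' => exists t r, [/\ (r <= 1)%N, nmem s' vQ 0 = (2 ^ t)%N,
      nmem s' vM 0 = (8 ^ r * 2 ^ t)%N & reduced P T t r (rmem s' rX)]).
Proof.
have [C hC] := run_level.
set e := ltN (nmul 8 (nv vQ)) (nv vM).
pose K := (C + (bcost e).+1)%N.
exists (K + (bcost e).+1)%N => R s P T sM sQ sX.
pose Inv p (s' : state R) := exists t r, [/\ nmem s' vQ 0 = (2 ^ t)%N,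
  nmem s' vM 0 = (8 ^ r * 2 ^ t)%N, reduced P T t r (rmem s' rX) &
  p = (K * (8 ^ r * 4 ^ t))%N].
have be (s' : state R) t r : nmem s' vQ 0 = (2 ^ t)%N ->
    nmem s' vM 0 = (8 ^ r * 2 ^ t)%N -> beval s' e = (1 < r)%N.
  move=> eQ eM; rewrite beval_ltN /= eQ eM.
  case: r {eM} => [|[|r]]; rewrite ?expn0 ?expn1 ?mul1n /=; try lia.
  have : (0 < 8 ^ r)%N by rewrite expn_gt0.
  have : (0 < 2 ^ t)%N by rewrite expn_gt0.
  by rewrite !expnS; nia.
apply: (@run_weaken _ _ _ (K * 8 ^ T + (bcost e).+1) _
  (fun s' => ~~ beval s' e /\ exists p, Inv p s')); last first.
- move=> s' fr [nb [p [t [r [eQ eM red _]]]]]; exists t, r; split=> //.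
  by rewrite (be _ t r) // -leqNgt in nb.
- by rewrite [X in (_ <= X)%N]mulnDl leq_add2l leq_pmulr ?expn_gt0.
apply: run_while.
  exists 0%N, T; rewrite !muln1; split=> //; split=> //.
  - by rewrite lt0n orNb.
  - by move=> p _; rewrite mul1n muln1 (eq_cnt _ sX).
  - by move=> p _; rewrite !muln1 (eq_cnt _ sX).
move=> p s1 fr1 [t [r [eQ eM red ->]]]; rewrite (be _ t r) //.
case: r eM red => [|[|r]] // eM red _.
have eM' : nmem s1 vM 0 = (8 ^ r.+1 * (8 * 2 ^ t))%N by rewrite eM (expnS 8 r.+1); lia.
have q0 : (0 < 2 ^ t)%N by rewrite expn_gt0.
exists (C * ((8 ^ r.+1).+1 * (2 ^ t) ^ 2))%N.
apply: (run_weaken (hC R s1 _ _ q0 eQ eM')) => // s2 fr2 [eQ2 eM2 hd hu].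
have e1 : (8 ^ r.+1 * (2 * 2 ^ t) = 8 ^ r.+1 * 2 ^ t.+1)%N by rewrite (expnS 2).
have e2 : (8 ^ r.+1 * (8 * 2 ^ t) = 8 ^ r.+2 * 2 ^ t)%N by rewrite (expnS 8 r.+1) mulnCA mulnA.
rewrite e1 in eM2; rewrite e1 e2 in hd hu.
exists (K * (8 ^ r.+1 * 4 ^ t.+1))%N.
  exists t.+1, r.+1; split=> //; first by rewrite eQ2 expnS.
  exact: reduced_step hd hu red.
have e4 : ((2 ^ t) ^ 2 = 4 ^ t)%N by rewrite -expnM mulnC expnM.
rewrite e4 (expnS 8 r.+1) (expnS 4) /K.
have : (0 < 8 ^ r.+1)%N by rewrite expn_gt0.
have : (0 < 4 ^ t)%N by rewrite expn_gt0.
move: (8 ^ r.+1)%N (4 ^ t)%N (bcost e).+1 => x y z y0 x0.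
have h1 : (C * (x.+1 * y) <= 2 * C * (x * y))%N by nia.
have h2 : (z <= z * (x * y))%N by rewrite leq_pmulr // muln_gt0 x0.
have -> : (8 * x * y = 8 * (x * y))%N by lia.
have -> : (x * (4 * y) = 4 * (x * y))%N by lia.
move: (x * y)%N h1 h2 => w h1 h2; nia.
Qed.

(** Of the constant 64, one factor 8 is lost because the sampled prefix may cover only an eighth of
    the items, the other in the rank bound within that prefix. *)
Lemma run_pivot : exists C, forall (R : realType) (s : state R),
  (0 < nmem s vN 0)%N ->
  run pivot_cmd s (C * nmem s vN 0)%N (fun s' =>
    (nmem s vN 0 <= 64 * cnt (fun x => (x <= rmem s' rPV 0)%R) (rmem s rP) (nmem s vN 0))%N /\
    (nmem s vN 0 <= 64 * cnt (fun x => (rmem s' rPV 0 <= x)%R) (rmem s rP) (nmem s vN 0))%N).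
Proof.
have [[C1 hC1] [C2 hC2] [C3 hC3] [C4 hC4]] := And4 run_grow run_copy run_reduce run_sort.
set c5 := SetR rPV (NConst 0) (RGet rX (NSub (nv vM) (nmul 7 (nv vQ)))).
exists (C1 + 2 * C2 + 10 + C3 + 81 * C4 + scost c5)%N => R s.
set n := nmem s vN 0; set P := rmem s rP => n0.
pose Q (s' : state R) := exists T, (8 ^ T <= n < 8 * 8 ^ T)%N /\
  ((8 ^ T <= 8 * cnt (fun x => (x <= rmem s' rPV 0)%R) P (8 ^ T))%N /\
   (8 ^ T <= 8 * cnt (fun x => (rmem s' rPV 0 <= x)%R) P (8 ^ T))%N).
apply: (@run_weaken _ _ _ (C1 * n + (C2 * n.+1 + (3 + (C3 * n + (3 + (4 + (C4 * (81 * n) + scost c5))))))) _ Q); last first.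
- move=> s' _ [T [/andP[Tn nT] [h1 h2]]].
  have := leq_cnt (fun x => x <= rmem s' rPV 0) P Tn.
  have := leq_cnt (fun x => rmem s' rPV 0 <= x) P Tn.
  by lia.
- move: (scost c5) => w.
  have : (w <= w * n)%N by rewrite leq_pmulr.
  have : (C2 * n.+1 <= 2 * C2 * n)%N by nia.
  by rewrite !mulnDl; lia.
apply: (run_seq (hC1 R s n0)) => s1 fr1 [T [sM1 Tn]].
have P1 k : rmem s1 rP k = P k by rewrite fr1.2.
have cp := hC2 R s1; rewrite sM1 in cp.
have cp' : run copy_cmd s1 (C2 * n.+1)%N (fun s' =>
    forall k, (k < 8 ^ T)%N -> rmem s' rX k = P k).
  apply: (run_weaken cp) => [|s' _ h k kT]; last by rewrite h.
  by rewrite leq_mul2l ltnS; case/andP: Tn => ->; rewrite orbT.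
apply: (run_seq cp') => s2 fr2 X2.
have q1 : run (assign vQ (NConst 1)) s2 3 (fun s' => s' = setn s2 vQ 0 1).
  exact: (run_sexec (c := assign vQ (NConst 1))).
apply: (run_seq q1) => s3 _ ->.
have red : run (While (ltN (nmul 8 (nv vQ)) (nv vM)) level_cmd) (setn s2 vQ 0 1) (C3 * n)%N
    (fun s' => exists t r, [/\ (r <= 1)%N, nmem s' vQ 0 = (2 ^ t)%N,
      nmem s' vM 0 = (8 ^ r * 2 ^ t)%N & reduced P T t r (rmem s' rX)]).
  apply: (run_weaken (hC3 R (setn s2 vQ 0 1) P T _ _ X2)) => //.
    by rewrite /= /upd /= fr2.1.
  by rewrite leq_mul2l; case/andP: Tn => ->; rewrite orbT.
apply: (run_seq red) => s4 _ [t [r [r1 sQ4 sM4 red4]]].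
have st : run (assign vST (NConst 0)) s4 3 (fun s' => s' = setn s4 vST 0 0).
  exact: (run_sexec (c := assign vST (NConst 0))).
apply: (run_seq st) => s5 _ ->.
have en : run (assign vEN (nv vM)) (setn s4 vST 0 0) 4
    (fun s' => s' = setn (setn s4 vST 0 0) vEN 0 (8 ^ r * 2 ^ t)).
  by apply: (run_sexec (c := assign vEN (nv vM))) => //=; rewrite /upd /= sM4.
apply: (run_seq en) => s6 _ ->.
have := hC4 R (setn (setn s4 vST 0 0) vEN 0 (8 ^ r * 2 ^ t)); rewrite /= /upd /= subn0.
move=> /(_ isT) srt.
have srt' : run sort_cmd (setn (setn s4 vST 0 0) vEN 0 (8 ^ r * 2 ^ t)) (C4 * (81 * n))%N
  (fun s' => sorting 0 (8 ^ r * 2 ^ t) (8 ^ r * 2 ^ t) (rmem s4 rX) (rmem s' rX)).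
  apply: (run_weaken srt) => //; rewrite leq_mul2l; apply/orP; right.
  (* The last array is so short that even its quadratic sort is paid for:
     [(2 ^ t) ^ 2 <= 8 ^ T <= n]. *)
  have e1 : ((8 ^ r * 2 ^ t).+1 <= 9 * 2 ^ t)%N.
    have : (0 < 2 ^ t)%N by rewrite expn_gt0.
    by case: r r1 {srt red4 sM4 en} => [|[|]]; rewrite ?expn0 ?expn1; lia.
  apply: (@leq_trans ((9 * 2 ^ t) ^ 2)); first by rewrite leq_exp2r.
  rewrite expnMn leq_mul2l /=.
  apply: (@leq_trans (8 ^ T)); last by case/andP: Tn.
  case: red4 => <- _ _ _; rewrite -expnM -(expnM 2 3 (t + r)) leq_exp2l //; lia.
apply: (run_seq srt') => s7 fr7 [_ sX cX].
apply: run_sexec => //; exists T; split=> //.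
have eM7 : nmem s7 vM 0 = (8 ^ r * 2 ^ t)%N by rewrite fr7.1.
have eQ7 : nmem s7 vQ 0 = (2 ^ t)%N by rewrite fr7.1.
apply: (@reduced_pivot _ P (rmem s7 rX) T t r) => //.
(* [reduced] sees the array only through counts, so it survives the final sort. *)
- case: red4 => h1 h2 h3 h4; split=> // p hp; rewrite cX //; [exact: h3|exact: h4].
- by move=> j k jk; apply: sX; lia.
- rewrite /= /upd /= eM7 eQ7; congr (rmem s7 _ _); lia.
Qed.

(** * Prune and search for the multiplier *)

Notation rA1 := 23%N (only parsing).
Notation rB1 := 24%N (only parsing).

Definition item (R : realType) (s : state R) (k : nat) : R * R := (rmem s rP k, rmem s rS k).

Definition items (R : realType) (s : state R) : seq (R * R) :=
  mkseq (item s) (nmem s vN 0).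

Lemma eq_in_mkseq (T : Type) (f g : nat -> T) n :
  (forall k, (k < n)%N -> f k = g k) -> mkseq f n = mkseq g n.
Proof. by move=> h; apply/eq_in_map => k; rewrite mem_iota add0n => /h. Qed.

Lemma count_items (R : realType) (s : state R) (p : R -> bool) :
  count (fun x => p x.1) (items s) = cnt p (rmem s rP) (nmem s vN 0).
Proof.
rewrite -sum1_count big_map /= /cnt -(big_mkord xpredT (fun k => nat_of_bool (p (rmem s rP k)))).
by rewrite big_mkcond /index_iota subn0; apply: eq_bigr => k _; case: (p _).
Qed.

Definition compact_step (test : bexp) : cmd :=
  If test (Seq (SetR rP (nv vO) (RGet rP (nv vK)))
          (Seq (SetR rS (nv vO) (RGet rS (nv vK)))
               (assign vO (NAdd (nv vO) (NConst 1))))) Skip.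

Definition compact_cmd (test : bexp) : cmd :=
  Seq (assign vO (NConst 0))
  (Seq (for_ vK (NConst 0) (ltN (nv vK) (nv vN)) (compact_step test)) (assign vN (nv vO))).

(** The write position never passes the read position, so cells still to be read are intact. The
    test has to be specified on all states with the same pivot, since the items move during the
    loop. *)
Lemma run_compact (test : bexp) : exists C, forall (R : realType) (s : state R) (keep : R -> bool),
  (forall s' : state R, rmem s' rPV 0 = rmem s rPV 0 ->
    beval s' test = keep (rmem s' rP (nmem s' vK 0))) ->
  run (compact_cmd test) s (C * (nmem s vN 0).+1)%N
    (fun s' => items s' = [seq x <- items s | keep x.1]).
Proof.
set f := for_ vK (NConst 0) (ltN (nv vK) (nv vN)) (compact_step test).
pose C := (scost (compact_step test) + forcost (NConst 0) (ltN (nv vK) (nv vN)))%N.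
exists (3 + C + 4)%N => R s keep ht; set n := nmem s vN 0.
pose fs k := [seq x <- mkseq (item s) k | keep x.1].
pose Inv k (s' : state R) := [/\ nmem s' vO 0 = size (fs k),
  mkseq (item s') (size (fs k)) = fs k & forall j, (k <= j)%N -> item s' j = item s j].
have szfs k : (size (fs k) <= k)%N.
  by rewrite -{2}(size_mkseq (item s) k) size_filter count_size.
apply: (@run_weaken _ _ _ (3 + ((n - 0).+1 * C + 4)) _
  (fun s' => items s' = [seq x <- items s | keep x.1])) => //; last first.
  by rewrite subn0; nia.
have h1 : run (assign vO (NConst 0)) s 3 (fun s' => s' = setn s vO 0 0).
  exact: (run_sexec (c := assign vO (NConst 0))).
apply: (run_seq h1) => s1 _ ->.
have h2 : run f (setn s vO 0 0) ((n - 0).+1 * C)%N (fun s' => nmem s' vK 0 = n /\ Inv n s').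
  apply: (run_for_const (Inv := Inv) (n := n)) => //.
    by move=> k s' fr ik _; rewrite beval_ltN /= ik fr.1.
  move=> k s' fr ik /= kn [iO iI iR]; apply: run_sexec => //.
  have fsS : fs k.+1 = if keep (rmem s rP k) then rcons (fs k) (item s k) else fs k.
    by rewrite /fs mkseqS filter_rcons.
  have [Pk Sk] : rmem s' rP k = rmem s rP k /\ rmem s' rS k = rmem s rS k.
    by have [-> ->] := iR k (leqnn k).
  rewrite [sexec _ _]/= ht; last by rewrite fr.2.
  rewrite ik Pk /Inv fsS; case: ifP => _; last first.
    by split=> // j kj; apply: iR; apply: ltnW.
  set s2 := setn _ _ _ _.
  have step j : item s2 j = if j == size (fs k) then item s k else item s' j.
    rewrite /item /= /upd /= iO ?Sk; case: eqP => // _.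
  split; first by rewrite /= /upd /= iO size_rcons addn1.
    rewrite size_rcons mkseqS (eq_in_mkseq (g := item s')) ?iI; last first.
      by move=> j jk; rewrite step ltn_eqF.
    by rewrite step eqxx.
  move=> j kj; rewrite step gtn_eqF; first by apply: iR; apply: ltnW.
  exact: leq_ltn_trans (szfs k) kj.
apply: (run_seq h2) => s2 fr2 [_ [iO iI _]].
apply: (run_sexec (c := assign vN (nv vO))) => //.
by rewrite /items /= /upd /= iO -[RHS]iI.
Qed.

Definition slope_step : cmd :=
  If (BLeR (RGet rP (nv vK)) (rv rPV))
    (Seq (SetR rA1 (NConst 0) (RAdd (rv rA1) (RGet rS (nv vK))))
         (SetR rB1 (NConst 0) (RAdd (rv rB1) (RMul (RGet rS (nv vK)) (RGet rP (nv vK)))))) Skip.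

(** The new slope and constant are tentative: they serve to evaluate the sum at the pivot and are
    adopted only if the search moves right. *)
Definition slope_cmd : cmd :=
  Seq (Seq (SetR rA1 (NConst 0) (rv rA)) (SetR rB1 (NConst 0) (rv rB)))
    (for_ vK (NConst 0) (ltN (nv vK) (nv vN)) slope_step).

Lemma run_slope : exists C, forall (R : realType) (s : state R),
  run slope_cmd s (C * (nmem s vN 0).+1)%N (fun s' =>
    rmem s' rA1 0 = rmem s rA 0 + \sum_(x <- items s | x.1 <= rmem s rPV 0) x.2 /\
    rmem s' rB1 0 = rmem s rB 0 + \sum_(x <- items s | x.1 <= rmem s rPV 0) x.2 * x.1).
Proof.
pose C := (scost slope_step + forcost (NConst 0) (ltN (nv vK) (nv vN)))%N.
set c1 := Seq (SetR rA1 (NConst 0) (rv rA)) (SetR rB1 (NConst 0) (rv rB)).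
exists (scost c1 + C)%N => R s; set n := nmem s vN 0; set pv := rmem s rPV 0.
pose Inv k (s' : state R) :=
  rmem s' rA1 0 = rmem s rA 0 + \sum_(x <- mkseq (item s) k | x.1 <= pv) x.2 /\
  rmem s' rB1 0 = rmem s rB 0 + \sum_(x <- mkseq (item s) k | x.1 <= pv) x.2 * x.1.
apply: (@run_weaken _ _ _ (scost c1 + (n - 0).+1 * C) _ (fun s' => nmem s' vK 0 = n /\ Inv n s')).
- apply: (@run_seq _ _ _ _ _ _ (fun s' => Inv 0%N s')).
    by apply: run_sexec => //; split; rewrite /= /upd /= !big_nil addr0.
  move=> s1 fr1 i1.
  apply: (run_for_const (Inv := Inv) (n := n)) => //.
    by move=> k s' fr ik _; rewrite beval_ltN /= ik fr.1 // fr1.1.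
  move=> k s' fr ik kn [iA iB]; apply: run_sexec => //=.
  have eP : rmem s' rP k = rmem s rP k by rewrite fr.2 // fr1.2.
  have eS : rmem s' rS k = rmem s rS k by rewrite fr.2 // fr1.2.
  have epv : rmem s' rPV 0 = pv by rewrite fr.2 // fr1.2.
  rewrite ik eP epv /Inv mkseqS !big_rcons /=.
  case: ifP => _; last by rewrite !addr0.
  rewrite /= /upd /= eP eS iA iB; split; rewrite -!addrA; congr (_ + _); exact: addrC.
- by rewrite subn0; nia.
- by move=> s' _ [].
Qed.

(** * Sums of hinges and the search invariant *)

Definition hinge (R : realType) (x : R) : R := Num.max 0 x.

Definition hinges (R : realType) (W : seq (R * R)) (lam : R) : R :=
  \sum_(x <- W) x.2 * hinge (lam - x.1).

Lemma hinge_ge0 (R : realType) (x : R) : 0 <= x -> hinge x = x.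
Proof. by move=> x0; rewrite /hinge max_r. Qed.

Lemma hinge_le0 (R : realType) (x : R) : x <= 0 -> hinge x = 0.
Proof. by move=> x0; rewrite /hinge max_l. Qed.

(** A hinge that has opened by [pv] is affine to the right of [pv], so it can be merged into slope
    and constant. *)
Lemma hinges_right (R : realType) (W : seq (R * R)) (pv lam : R) : pv <= lam ->
  hinges W lam = (\sum_(x <- W | x.1 <= pv) x.2) * lam - \sum_(x <- W | x.1 <= pv) x.2 * x.1
    + hinges [seq x <- W | pv < x.1] lam.
Proof.
move=> pl; rewrite /hinges (bigID (fun x : R * R => x.1 <= pv)) /=; congr (_ + _).
  rewrite mulr_suml -sumrB; apply: eq_bigr => x xp.
  by rewrite hinge_ge0 ?mulrBr // subr_ge0 (le_trans xp).
by rewrite big_filter; apply: eq_bigl => x; rewrite -ltNge.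
Qed.

Lemma hinges_left (R : realType) (W : seq (R * R)) (pv lam : R) : lam <= pv ->
  hinges W lam = hinges [seq x <- W | x.1 < pv] lam.
Proof.
move=> pl; rewrite /hinges big_filter [RHS]big_mkcond; apply: eq_bigr => x _.
case: ltP => // px; rewrite hinge_le0 ?mulr0 // subr_le0.
exact: le_trans px.
Qed.

(* [phi] is a ghost variable: the program does not need the right end of the
   interval that still contains the multiplier. *)
Definition searching (R : realType) (F : R -> R) (T c0 : R)
    (plo A B : R) (W : seq (R * R)) : Prop :=
  exists phi, [/\ plo <= phi, F plo <= T <= F phi,
    forall lam, plo <= lam <= phi -> F lam = c0 + A * lam - B + hinges W lam &
    forall x, x \in W -> plo <= x.1 <= phi].

(** Remaining breakpoints on both sides place [pv] in the interval where the formula for [F] is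
    valid, and hinges beyond [pv] vanish at [pv]. *)
Lemma searching_val (R : realType) (F : R -> R) T c0 plo A B W pv :
  searching F T c0 plo A B W ->
  has (fun x => x.1 <= pv) W -> has (fun x => pv <= x.1) W ->
  F pv = c0 + (A + \sum_(x <- W | x.1 <= pv) x.2) * pv
    - (B + \sum_(x <- W | x.1 <= pv) x.2 * x.1).
Proof.
move=> [phi [_ _ hF hW]] /hasP[x /hW /andP[xlo _] xp] /hasP[y /hW /andP[_ yhi] py].
rewrite hF; last by rewrite (le_trans xlo xp) (le_trans py yhi).
rewrite (hinges_right W (lexx pv)).
suff -> : hinges [seq x <- W | pv < x.1] pv = 0 by ring.
rewrite /hinges big_filter big1 // => z pz.
by rewrite hinge_le0 ?mulr0 // subr_le0 ltW.
Qed.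

Lemma searching_right (R : realType) (F : R -> R) T c0 plo A B W pv :
  searching F T c0 plo A B W ->
  has (fun x => x.1 <= pv) W -> has (fun x => pv <= x.1) W -> F pv <= T ->
  searching F T c0 pv (A + \sum_(x <- W | x.1 <= pv) x.2)
    (B + \sum_(x <- W | x.1 <= pv) x.2 * x.1) [seq x <- W | pv < x.1].
Proof.
move=> [phi [_ /andP[_ Tphi] hF hW]] /hasP[x /hW /andP[xlo _] xp] /hasP[y /hW /andP[_ yhi] py] FT.
exists phi; split.
- exact: le_trans py yhi.
- by rewrite FT.
- move=> lam /andP[pl lp]; rewrite hF ?lp ?(le_trans (le_trans xlo xp)) //.
  by rewrite (hinges_right W pl); ring.
- by move=> z; rewrite mem_filter => /andP[/ltW -> /hW /andP[_ ->]].
Qed.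

Lemma searching_left (R : realType) (F : R -> R) T c0 plo A B W pv :
  searching F T c0 plo A B W ->
  has (fun x => x.1 <= pv) W -> has (fun x => pv <= x.1) W -> T <= F pv ->
  searching F T c0 plo A B [seq x <- W | x.1 < pv].
Proof.
move=> [phi [_ /andP[Tlo _] hF hW]] /hasP[x /hW /andP[xlo _] xp] /hasP[y /hW /andP[_ yhi] py] FT.
exists pv; split.
- exact: le_trans xlo xp.
- by rewrite Tlo.
- move=> lam /andP[pl lp]; rewrite hF ?pl ?(le_trans lp (le_trans py yhi)) //.
  by rewrite (hinges_left W lp).
- by move=> z; rewrite mem_filter => /andP[/ltW -> /hW /andP[->]].
Qed.

(** Without breakpoints [F] is affine on the interval and the linear equation gives the multiplier.
    For zero slope [F] is constant there, hence equal to [T], and the left end will do. *)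
Lemma searching_nil (R : realType) (F : R -> R) T c0 plo A B :
  searching F T c0 plo A B [::] ->
  F (if (A <= 0) && (0 <= A) then plo else (T - c0 + B) / A) = T.
Proof.
move=> [phi [lohi /andP[loT Thi] hF _]].
have {}hF lam : plo <= lam <= phi -> F lam = c0 + A * lam - B.
  by move=> /hF ->; rewrite /hinges big_nil addr0.
have := hF phi; have := hF plo; rewrite lohi !lexx => /(_ isT) Flo /(_ isT) Fhi.
rewrite -eq_le; case: eqP => [A0|/eqP A0].
  by apply/eqP; rewrite eq_le loT; move: Thi; rewrite Fhi Flo A0 !mul0r.
rewrite Flo in loT; rewrite Fhi in Thi.
have e : A * ((T - c0 + B) / A) = T - c0 + B by rewrite mulrC divfK.
rewrite hF; first by rewrite e; ring.
(* On a one-point interval the slope has no known sign, and the root has to be identified with that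
   point. *)
have [lohi'|] := ltP plo phi; last first.
  move=> hilo; have ephi : phi = plo by apply/eqP; rewrite eq_le hilo.
  suff -> : (T - c0 + B) / A = plo by rewrite lexx.
  by apply: (mulfI A0); rewrite e; rewrite ephi in Thi; lra.
(* The values at the two ends are in increasing order, which leaves only a positive slope; then the
   root lies between the ends. *)
have A_gt0 : 0 < A.
  rewrite lt_neqAle eq_sym A0 /= -(ler_pM2r (x := phi - plo)) ?subr_gt0 // mul0r; lra.
by rewrite -(ler_pM2l A_gt0 plo) -(ler_pM2l A_gt0 _ phi) e; apply/andP; split; lra.
Qed.

Definition prune_test : bexp :=
  BLeR (RSub (RAdd (rv rC0) (RMul (rv rA1) (rv rPV))) (rv rB1)) (rv rT).

Definition keep_right : bexp := BNot (BLeR (RGet rP (nv vK)) (rv rPV)).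
Definition keep_left : bexp := BNot (BLeR (rv rPV) (RGet rP (nv vK))).

Definition move_right : cmd :=
  Seq (SetR rPLO (NConst 0) (rv rPV))
  (Seq (SetR rA (NConst 0) (rv rA1)) (SetR rB (NConst 0) (rv rB1))).

Definition prune_cmd : cmd :=
  Seq pivot_cmd (Seq slope_cmd
    (If prune_test (Seq move_right (compact_cmd keep_right)) (compact_cmd keep_left))).

Definition searching_state (R : realType) (F : R -> R) (T c0 : R) (s : state R) : Prop :=
  [/\ rmem s rT 0 = T, rmem s rC0 0 = c0 &
   searching F T c0 (rmem s rPLO 0) (rmem s rA 0) (rmem s rB 0) (items s)].

Lemma run_prune : exists C, forall (R : realType) (F : R -> R) (T c0 : R) (s : state R),
  (0 < nmem s vN 0)%N -> searching_state F T c0 s ->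
  run prune_cmd s (C * nmem s vN 0)%N (fun s' => searching_state F T c0 s' /\
    (nmem s vN 0 <= 64 * (nmem s vN 0 - nmem s' vN 0))%N /\ (nmem s' vN 0 <= nmem s vN 0)%N).
Proof.
have [[C1 hC1] [C2 hC2] [C3 hC3] [C4 hC4]] :=
  And4 run_pivot run_slope (run_compact keep_right) (run_compact keep_left).
exists (C1 + 2 * C2 + (bcost prune_test + scost move_right).+1 + 2 * C3 + 2 * C4)%N.
move=> R F T c0 s; set n := nmem s vN 0 => n0 [sT sc0 inv].
have szW : size (items s) = n by rewrite size_mkseq.
set Q := fun s' : state R => _.
apply: (@run_weaken _ _ _ (C1 * n + (C2 * n.+1 + (bcost prune_test + (scost move_right + C3 * n.+1 + C4 * n.+1)).+1)) _ Q) => //; last first.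
  move: (bcost _) (scost _) => w z.
  have : (C2 * n.+1 <= 2 * C2 * n)%N by nia.
  have : (C3 * n.+1 <= 2 * C3 * n)%N by nia.
  have : (C4 * n.+1 <= 2 * C4 * n)%N by nia.
  have : ((w + z).+1 <= (w + z).+1 * n)%N by rewrite leq_pmulr.
  by rewrite !mulnDl; lia.
apply: (run_seq (hC1 R s n0)) => s1 fr1; rewrite -!count_items -/n.
set pv := rmem s1 rPV 0 => -[].
change ((n <= 64 * count (fun x : R * R => (x.1 <= pv)%R) (items s))%N ->
  (n <= 64 * count (fun x : R * R => (pv <= x.1)%R) (items s))%N -> run (Seq slope_cmd
    (If prune_test (Seq move_right (compact_cmd keep_right)) (compact_cmd keep_left))) s1
  (C2 * n.+1 + (bcost prune_test + (scost move_right + C3 * n.+1 + C4 * n.+1)).+1) Q) => cle cge.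
have W1 : items s1 = items s.
  by rewrite /items fr1.1 //; apply: eq_in_mkseq => k _; rewrite /item !fr1.2.
have pos m : (n <= 64 * m)%N -> (0 < m)%N by lia.
have hle : has (fun x => x.1 <= pv) (items s) by rewrite has_count pos.
have hge : has (fun x => pv <= x.1) (items s) by rewrite has_count pos.
have sl := hC2 R s1; rewrite W1 !(fr1.1 vN) // (fr1.2 rA) // (fr1.2 rB) // -/n -/pv in sl.
apply: (run_seq sl) => s2 fr2 [eA1 eB1].
have W2 : items s2 = items s.
  by rewrite -W1 /items fr2.1 //; apply: eq_in_mkseq => k _; rewrite /item !fr2.2.
have n2 : nmem s2 vN 0 = n by rewrite -szW -W2 size_mkseq.
have pv2 : rmem s2 rPV 0 = pv by rewrite fr2.2.
have [T2 c2] : rmem s2 rT 0 = T /\ rmem s2 rC0 0 = c0 by rewrite !fr2.2 // !fr1.2.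
have Fpv := searching_val inv hle hge.
have be : beval s2 prune_test = (F pv <= T) by rewrite /= c2 eA1 eB1 pv2 T2 Fpv.
have removed p (W' : seq (R * R)) : W' = [seq x <- items s | ~~ p x] ->
    (n <= 64 * count p (items s))%N -> (n <= 64 * (n - size W') /\ size W' <= n)%N.
  move=> ->; rewrite size_filter -szW -(count_predC p (items s)).
  by rewrite addnK => h; split=> //; apply: leq_addl.
apply: run_if; rewrite be; case: ifP => [FT|/negbT]; last first.
  rewrite -ltNge => /ltW FT.
  have cp := hC4 R s2 (fun x => ~~ (pv <= x)); rewrite n2 in cp.
  apply: (run_weaken (cp _)) => [s' epv /=||s3 fr3 W3]; [by rewrite epv pv2|by rewrite leq_addl|].
  have sz3 : size (items s3) = nmem s3 vN 0 by rewrite size_mkseq.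
  rewrite W2 in W3; have := removed (fun x => pv <= x.1) _ W3 cge; rewrite sz3; split=> //.
  split; rewrite ?fr3.2 // W3 2?fr2.2 // 2?fr1.2 //.
  have := searching_left inv hle hge FT.
  rewrite (fr2.2 rB) // (fr1.2 rB) //.
  by rewrite (eq_filter (a2 := fun x => ~~ (pv <= x.1))) // => x; rewrite ltNge.
set s2' := sexec move_right s2.
have mv : run move_right s2 (scost move_right) (fun s' => s' = s2') by exact: run_sexec.
apply: (@run_weaken _ _ _ (scost move_right + C3 * n.+1) _ Q) => //; last by rewrite leq_addr.
apply: (run_seq mv) => s3 _ ->.
have cp := hC3 R s2' (fun x => ~~ (x <= pv)).
have cp' := cp _; rewrite /= /upd /= n2 in cp'.
apply: (run_weaken (cp' _)) => [s' epv /=||s4 fr4 W4]; [by rewrite epv pv2|by []|].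
have sz4 : size (items s4) = nmem s4 vN 0 by rewrite size_mkseq.
have W2' : items s2' = items s by [].
rewrite W2' in W4; have := removed (fun x => x.1 <= pv) _ W4 cle; rewrite sz4; split=> //.
split; rewrite ?fr4.2 // W4 /= /upd /= eA1 eB1 pv2.
have := searching_right inv hle hge FT.
by rewrite (eq_filter (a2 := fun x => ~~ (x.1 <= pv))) // => x; rewrite ltNge.
Qed.

Definition search_cmd : cmd := While (ltN (NConst 0) (nv vN)) prune_cmd.

(* Each round removes at least 1/64 of the items, so 64 times the cost of a round
   per remaining item is a potential. *)
Lemma run_search : exists C, forall (R : realType) (F : R -> R) (T c0 : R) (s : state R),
  searching_state F T c0 s ->
  run search_cmd s (C * (nmem s vN 0).+1)%N
    (fun s' => searching_state F T c0 s' /\ items s' = [::]).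
Proof.
have [C hC] := run_prune.
set e := ltN (NConst 0) (nv vN).
have [w ew] : exists w, w = (bcost e).+1 by exists (bcost e).+1.
pose K := (64 * (C + w))%N.
exists (K + w)%N => R F T c0 s inv.
pose Inv p (s' : state R) := searching_state F T c0 s' /\ p = (K * nmem s' vN 0)%N.
apply: (@run_weaken _ _ _ (K * nmem s vN 0 + w) _
  (fun s' => ~~ beval s' e /\ exists p, Inv p s')); last first.
- move=> s' _ [nb [p [inv' _]]]; split=> //; apply: size0nil; rewrite size_mkseq.
  by move: nb; rewrite beval_ltN /=; lia.
- by rewrite mulnS mulnDl; lia.
rewrite ew; apply: run_while => // p s1 _ [inv1 ->]; rewrite beval_ltN /= => n0.
exists (C * nmem s1 vN 0)%N.
apply: (run_weaken (hC R F T c0 s1 n0 inv1)) => // s2 _ [inv2 [le1 le2]].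
exists (K * nmem s2 vN 0)%N => //.
apply: (@leq_trans (C * nmem s1 vN 0 + w + K * nmem s2 vN 0)); first by rewrite ew.
rewrite /K.
move: (nmem s1 vN 0) (nmem s2 vN 0) n0 le1 le2 => n n' n0 le1 le2.
have h1 : (C * n + w <= (C + w) * n)%N by rewrite mulnDl leq_add2l leq_pmulr.
have h2 : ((C + w) * n <= 64 * (C + w) * (n - n'))%N by rewrite mulnAC mulnC leq_mul2r le1 orbT.
apply: (@leq_trans (64 * (C + w) * (n - n' + n'))); last by rewrite subnK.
by rewrite (mulnDr (64 * (C + w))) leq_add2r; apply: leq_trans h1 h2.
Qed.

(** The only comparison of reals is [<=], so a zero slope is detected by two inequalities. *)
Definition multiplier_cmd : cmd :=
  If (BAnd (BLeR (rv rA) (RConst 0)) (BLeR (RConst 0) (rv rA)))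
    (SetR rLAM (NConst 0) (rv rPLO))
    (SetR rLAM (NConst 0) (RDiv (RAdd (RSub (rv rT) (rv rC0)) (rv rB)) (rv rA))).

Lemma run_multiplier (R : realType) (F : R -> R) (T c0 : R) (s : state R) :
  searching_state F T c0 s -> items s = [::] ->
  run multiplier_cmd s (scost multiplier_cmd) (fun s' => F (rmem s' rLAM 0) = T).
Proof.
move=> [sT sc0 inv] nil; rewrite nil in inv.
apply: run_sexec => //; rewrite -[RHS](searching_nil inv); congr F.
by rewrite /= sT sc0; case: ifP => _; rewrite /= /upd.
Qed.

(** * Clamps as sums of hinges, and the start of the search *)

Definition clamp (R : realType) (x l u : R) : R :=
  if x < l then l else if u < x then u else x.

(** The unclamped value reaches [l] at [lam = a * l + b] and [u] at [lam = a * u + b]. The first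
    hinge starts the slope [1/a], the second cancels it. *)
Lemma clamp_hinge (R : realType) (a b l u lam : R) : 0 < a -> l <= u ->
  clamp ((lam - b) / a) l u =
  l + (a^-1 * hinge (lam - (a * l + b)) + - a^-1 * hinge (lam - (a * u + b))).
Proof.
move=> a0 lu; rewrite /clamp ltr_pdivrMr // ltr_pdivlMr //.
have aI : a * a^-1 = 1 by rewrite divff ?gt_eqF.
have alu : a * l <= a * u by rewrite ler_pM2l.
case: ltP => h1; first by rewrite !hinge_le0; [ring|lra|lra].
case: ltP => h2.
  rewrite !hinge_ge0; [|lra|lra].
  (* [ring] does not simplify [a * a^-1], so this product is exposed and rewritten by [aI]. *)
  transitivity (l + a * a^-1 * (u - l)); last by ring.
  by rewrite aI; ring.
rewrite hinge_ge0; last lra.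
rewrite hinge_le0; last lra.
transitivity (l * (1 - a * a^-1) + (lam - b) / a); last by ring.
by rewrite aI; ring.
Qed.

Definition breakpoints (R : realType) (a b lo up : nat -> R) (z : nat) : seq (R * R) :=
  [:: (a z * lo z + b z, (a z)^-1); (a z * up z + b z, - (a z)^-1)].

Definition clamped_sum (R : realType) (a b lo up : nat -> R) (Z : seq nat) (lam : R) : R :=
  \sum_(z <- Z) clamp ((lam - b z) / a z) (lo z) (up z).

Lemma upper_bound_seq (R : realType) (W : seq R) (y : R) :
  exists2 phi, y <= phi & forall x, x \in W -> x <= phi.
Proof.
elim: W => [|w W [phi yp hW]]; first by exists y.
exists (Num.max w phi) => [|x]; first by rewrite le_max yp orbT.
by rewrite inE le_max => /orP[/eqP ->|/hW ->]; rewrite ?lexx ?orbT.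
Qed.

(** To the left of all breakpoints every term sits at its lower bound, to the right of all of them
    at its upper bound, so solvability of the sum constraint is exactly the bracketing of [T]. *)
Lemma searching_start (R : realType) (a b lo up : nat -> R) (Z : seq nat) (T plo : R) :
  (forall z, z \in Z -> 0 < a z /\ lo z <= up z) ->
  \sum_(z <- Z) lo z <= T <= \sum_(z <- Z) up z ->
  (forall z, z \in Z -> plo <= a z * lo z + b z) ->
  searching (clamped_sum a b lo up Z) T (\sum_(z <- Z) lo z) plo 0 0
    (flatten [seq breakpoints a b lo up z | z <- Z]).
Proof.
move=> hZ /andP[loT Tup] hplo.
set W := flatten _.
have [phi lophi hphi] := upper_bound_seq (map fst W) plo.
have inW z : z \in Z -> (a z * lo z + b z, (a z)^-1) \in W /\ (a z * up z + b z, - (a z)^-1) \in W.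
  by move=> zZ; split; apply/flattenP; exists (breakpoints a b lo up z);
    rewrite ?map_f ?inE ?eqxx ?orbT.
have Wphi x : x \in W -> x.1 <= phi by move=> xW; apply/hphi/map_f.
have alu z : z \in Z -> a z * lo z <= a z * up z by move=> /hZ [a0 lu]; rewrite ler_pM2l.
have FE lam : clamped_sum a b lo up Z lam = \sum_(z <- Z) lo z + hinges W lam.
  rewrite /clamped_sum /hinges big_flatten big_map /= -big_split /=.
  rewrite big_seq [RHS]big_seq; apply: eq_bigr => z /hZ [a0 lu].
  by rewrite clamp_hinge // !big_cons big_nil addr0.
exists phi; split=> //.
- apply/andP; split.
    suff h0 : hinges W plo = 0 by rewrite FE h0 addr0.
    rewrite /hinges big_seq big1 // => x /flattenP[_ /mapP[z zZ ->]].
    have := hplo z zZ; have := alu z zZ => h1 h2.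
    by rewrite !inE => /orP[]/eqP -> /=; rewrite hinge_le0 ?mulr0 //; lra.
  apply: le_trans Tup _; rewrite /clamped_sum big_seq [leRHS]big_seq.
  apply: ler_sum => z zZ; have [a0 lu] := hZ z zZ.
  have := Wphi _ (inW z zZ).2; rewrite /= => h.
  have hu : up z <= (phi - b z) / a z by rewrite ler_pdivlMr //; lra.
  rewrite /clamp; case: ltP => h1; first by lra.
  by case: ltP.
- by move=> lam _; rewrite FE mul0r addr0 subr0.
- move=> x xW; rewrite Wphi // andbT.
  move: xW => /flattenP[_ /mapP[z zZ ->]].
  have := hplo z zZ; have := alu z zZ => h1 h2.
  by rewrite !inE => /orP[]/eqP -> /=; lra.
Qed.

(** * Programs for a problem with a single sum constraint *)

Notation rLO := 25%N (only parsing).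
Notation rUP := 26%N (only parsing).

Definition load_item : cmd := assign vI (NGet 4 (nv vE)).

Definition breakpoint (r : nat) : rexp :=
  RAdd (RMul (RGet 3 (nv vI)) (rv r)) (RGet 4 (nv vI)).

Definition ee : nexp := NAdd (nv vE) (nv vE).
Definition ee1 : nexp := NAdd (NAdd (nv vE) (nv vE)) (NConst 1).

Definition build_step (lo up : nat) : cmd :=
  Seq load_item
  (Seq (SetR rLO (NConst 0) (RGet lo (nv vI)))
  (Seq (SetR rUP (NConst 0) (RGet up (nv vI)))
  (Seq (SetR rP ee (breakpoint rLO))
  (Seq (SetR rS ee (RDiv (RConst 1) (RGet 3 (nv vI))))
  (Seq (SetR rP ee1 (breakpoint rUP))
  (Seq (SetR rS ee1 (RSub (RConst 0) (RDiv (RConst 1) (RGet 3 (nv vI)))))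
  (Seq (SetR rC0 (NConst 0) (RAdd (rv rC0) (rv rLO)))
  (If (ltR (RGet rP ee) (rv rPLO)) (SetR rPLO (NConst 0) (RGet rP ee)) Skip)))))))).

(** The running minimum in [rPLO] starts from the first listed index. For an empty list its value is
    arbitrary, and nothing is required of it. *)
Definition build_init (lo : nat) : cmd :=
  Seq (assign vI (NGet 4 (NConst 0)))
  (Seq (SetR rLO (NConst 0) (RGet lo (nv vI)))
  (Seq (SetR rPLO (NConst 0) (breakpoint rLO))
  (Seq (SetR rC0 (NConst 0) (RConst 0))
  (Seq (SetR rA (NConst 0) (RConst 0)) (SetR rB (NConst 0) (RConst 0)))))).

Definition build_cmd (lo up : nat) : cmd :=
  Seq (build_init lo)
  (Seq (for_ vE (NConst 0) (ltN (nv vE) (nv vC)) (build_step lo up))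
       (assign vN (NAdd (nv vC) (nv vC)))).

Definition indices (R : realType) (s : state R) : seq nat :=
  mkseq (nmem s 4) (nmem s vC 0).

(** With variable array numbers [lo], [up] and [out], membership in the list of written arrays does
    not compute; the threshold decides it instead. *)
Lemma notin_above (x : nat) (l : seq nat) : (x < 11)%N -> all (leq 11) l -> x \notin l.
Proof. by move=> x11 /allP hl; apply/negP => /hl; rewrite leqNgt x11. Qed.

Lemma eqn_above (x y : nat) : (x < 11)%N -> (11 <= y)%N -> (x == y) = false.
Proof. by move=> x11 y11; apply: ltn_eqF; apply: leq_trans y11. Qed.

Lemma run_build (lo up : nat) : (lo < 11)%N -> (up < 11)%N ->
  exists C, forall (R : realType) (s : state R),
  run (build_cmd lo up) s (C * (nmem s vC 0).+1)%N (fun s' =>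
    [/\ nmem s' vN 0 = (2 * nmem s vC 0)%N,
      items s' = flatten [seq breakpoints (rmem s 3) (rmem s 4) (rmem s lo) (rmem s up) z | z <- indices s],
      rmem s' rC0 0 = \sum_(z <- indices s) rmem s lo z,
      rmem s' rA 0 = 0 /\ rmem s' rB 0 = 0 &
      forall z, z \in indices s -> rmem s' rPLO 0 <= rmem s 3 z * rmem s lo z + rmem s 4 z]).
Proof.
move=> lo11 up11.
set f := for_ vE (NConst 0) (ltN (nv vE) (nv vC)) (build_step lo up).
pose C := (scost (build_step lo up) + forcost (NConst 0) (ltN (nv vE) (nv vC)))%N.
exists (scost (build_init lo) + C + 7)%N => R s; set c := nmem s vC 0.
pose bp := breakpoints (rmem s 3) (rmem s 4) (rmem s lo) (rmem s up).
pose Z := mkseq (nmem s 4).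
pose Inv k (s' : state R) := [/\ mkseq (item s') (k + k) = flatten (map bp (Z k)),
   rmem s' rC0 0 = \sum_(z <- Z k) rmem s lo z &
   forall z, z \in Z k -> rmem s' rPLO 0 <= rmem s 3 z * rmem s lo z + rmem s 4 z].
apply: (@run_weaken _ _ _ (scost (build_init lo) + ((c - 0).+1 * C + 7)) _ (fun s' =>
  [/\ nmem s' vN 0 = (c + c)%N, rmem s' rA 0 = 0 /\ rmem s' rB 0 = 0 & Inv c s'])); last first.
- move=> s' _ [eN AB [i1 i2 i3]]; split=> //; first by rewrite eN mul2n addnn.
  by rewrite /items eN i1.
- by rewrite subn0; nia.
apply: (@run_seq _ _ _ _ _ _ (fun s1 => rmem s1 rC0 0 = 0 /\ rmem s1 rA 0 = 0 /\ rmem s1 rB 0 = 0)).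
  by apply: run_sexec => //; rewrite /= /upd /= !mulr0z.
move=> s1 fr1 [C1 [A1 B1]].
have eq1 x k : (x < 11)%N -> rmem s1 x k = rmem s x k.
  by move=> x11; rewrite fr1.2 // notin_above.
have c1 : nmem s1 vC 0 = c by rewrite fr1.1.
have h2 : run f s1 ((c - 0).+1 * C)%N (fun s' => nmem s' vE 0 = c /\ Inv c s').
  apply: (run_for_const (Inv := Inv) (n := c)) => //.
  - by split; rewrite ?big_nil.
  - by move=> k s' fr ik _; rewrite beval_ltN /= ik fr.1 // c1.
  move=> k s' fr ik kc [i1 i2 i3]; apply: run_sexec => //.
  have eq' x j : (x < 11)%N -> rmem s' x j = rmem s x j.
    by move=> x11; rewrite fr.2 ?eq1 // notin_above.
  have eZ : nmem s' 4 k = nmem s 4 k by rewrite fr.1 // fr1.1.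
  set z := nmem s 4 k in eZ.
  pose p1 := rmem s 3 z * rmem s lo z + rmem s 4 z.
  have kk1 : (k + k == k + k + 1)%N = false by lia.
  rewrite [sexec _ _]/= /upd /= ik eZ (eqn_above up11) //.
  rewrite !(eq' 3) // !(eq' 4) // !(eq' lo) // !(eq' up) // -/p1 kk1 eqxx /=.
  rewrite mulr0z mulr1z sub0r div1r.
  set s2 := (X in if _ then _ else X).
  set s3 := (X in Inv _ X).
  have it3 j : item s3 j = if j == (k + k)%N then (p1, (rmem s 3 z)^-1)
      else if j == (k + k + 1)%N then (rmem s 3 z * rmem s up z + rmem s 4 z, - (rmem s 3 z)^-1)
      else item s' j.
    rewrite /s3 /item; case: ifP => _; rewrite /= /upd /=;
      by case: (j =P (k + k)%N) => [->|_]; rewrite ?kk1 //; case: eqP.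
  have C3 : rmem s3 rC0 0 = rmem s' rC0 0 + rmem s lo z.
    by rewrite /s3; case: ifP.
  have [plo3 plo3'] : rmem s3 rPLO 0 <= rmem s' rPLO 0 /\ rmem s3 rPLO 0 <= p1.
    rewrite /s3; case: (leP (rmem s' rPLO 0) p1) => h; rewrite /= /upd /=.
      by rewrite lexx.
    by rewrite lexx (ltW h).
  have ZS : Z k.+1 = rcons (Z k) z by rewrite /Z mkseqS.
  rewrite /Inv ZS map_rcons flatten_rcons big_rcons /= C3 i2; split=> //.
    rewrite addnS addSn !mkseqS -!cats1 -catA; congr (_ ++ _).
      rewrite -i1; apply: eq_in_mkseq => j jk; rewrite it3.
      by rewrite !ifF //; lia.
    by rewrite /= !it3 eqxx addn1 eqxx gtn_eqF.
  move=> y; rewrite mem_rcons inE => /orP[/eqP -> //|/i3].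
  exact: le_trans.
apply: (run_seq h2) => s2 fr2 [_ inv2].
apply: (@run_weaken _ _ _ (scost (assign vN (NAdd (nv vC) (nv vC)))) _ (fun s' =>
  [/\ nmem s' vN 0 = (c + c)%N, rmem s' rA 0 = 0 /\ rmem s' rB 0 = 0 & Inv c s'])) => //.
apply: run_sexec => //; split=> //=.
  by rewrite /upd /= fr2.1 // c1.
by rewrite !fr2.2.
Qed.

Definition write_step (lo up out : nat) : cmd :=
  Seq load_item
  (Seq (SetR out (nv vI) (RDiv (RSub (rv rLAM) (RGet 4 (nv vI))) (RGet 3 (nv vI))))
  (If (ltR (RGet out (nv vI)) (RGet lo (nv vI))) (SetR out (nv vI) (RGet lo (nv vI)))
  (If (ltR (RGet up (nv vI)) (RGet out (nv vI))) (SetR out (nv vI) (RGet up (nv vI))) Skip))).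

Definition write_cmd (lo up out : nat) : cmd :=
  for_ vE (NConst 0) (ltN (nv vE) (nv vC)) (write_step lo up out).

Definition clamped (R : realType) (a b lo up : nat -> R) (lam : R) (z : nat) : R :=
  clamp ((lam - b z) / a z) (lo z) (up z).

(** Cells outside the index list must be preserved, because the blocks write one after another into
    the same array. *)
Lemma run_write (lo up out : nat) : (out < 11)%N -> out \notin [:: lo; up; 3; 4] ->
  exists C, forall (R : realType) (s : state R),
  run (write_cmd lo up out) s (C * (nmem s vC 0).+1)%N (fun s' => forall i,
    rmem s' out i = if i \in indices s
      then clamped (rmem s 3) (rmem s 4) (rmem s lo) (rmem s up) (rmem s rLAM 0) i
      else rmem s out i).
Proof.
move=> out11; rewrite !inE !negb_or => /and4P[outlo outup out3 out4].
exists (scost (write_step lo up out) + forcost (NConst 0) (ltN (nv vE) (nv vC)))%N => R s.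
set c := nmem s vC 0; set x := clamped _ _ _ _ _.
pose Inv k (s' : state R) := forall i,
  rmem s' out i = if i \in mkseq (nmem s 4) k then x i else rmem s out i.
apply: (@run_weaken _ _ _ ((c - 0).+1 * (scost (write_step lo up out) + forcost (NConst 0) (ltN (nv vE) (nv vC)))) _
   (fun s' => nmem s' vE 0 = c /\ Inv c s')); last by move=> s' _ [].
  apply: (run_for_const (Inv := Inv) (n := c)) => //.
    by move=> k s' fr ik _; rewrite beval_ltN /= ik fr.1.
  move=> k s' fr ik kc inv; apply: run_sexec => // i.
  have eq' y j : y != out -> rmem s' y j = rmem s y j.
    by move=> yo; rewrite fr.2 // !inE !orbb.
  set z := nmem s 4 k.
  have eZ : nmem s' 4 k = z by rewrite fr.1.
  rewrite mkseqS mem_rcons inE -/z.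
  rewrite [sexec _ _]/= /upd /= ik eZ !eqxx /= !(eq_sym _ out) !(negPf outlo) !(negPf outup)
    ?(negPf out3) ?(negPf out4) ?(ltn_eqF (leq_trans out11 _)) //=.
  rewrite (eq' lo) 1?eq_sym // (eq' up) 1?eq_sym // (eq' 4) 1?eq_sym // (eq' 3) 1?eq_sym //.
  rewrite (eq' rLAM); last by rewrite gtn_eqF // (leq_trans out11).
  rewrite -!ltNge.
  have xz : x z = clamp ((rmem s rLAM 0 - rmem s 4 z) / rmem s 3 z) (rmem s lo z) (rmem s up z) by [].
  rewrite /clamp in xz; move: xz; case: ifP => _ xz; last move: xz; last case: ifP => _ xz;
    by rewrite /= /upd !eqxx /= -?xz; case: eqP => [->|_] //; rewrite -?xz ?inv.
by rewrite subn0 mulnC.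
Qed.

Definition solve_cmd (lo up out : nat) : cmd :=
  Seq (build_cmd lo up) (Seq search_cmd (Seq multiplier_cmd (write_cmd lo up out))).

Lemma run_solve (lo up out : nat) : (lo < 11)%N -> (up < 11)%N -> (out < 11)%N ->
  out \notin [:: lo; up; 3; 4] ->
  exists C, forall (R : realType) (s : state R),
  let a := rmem s 3 in let b := rmem s 4 in let Z := indices s in
  (forall z, z \in Z -> 0 < a z /\ rmem s lo z <= rmem s up z) ->
  \sum_(z <- Z) rmem s lo z <= rmem s rT 0 <= \sum_(z <- Z) rmem s up z ->
  run (solve_cmd lo up out) s (C * (nmem s vC 0).+1)%N (fun s' => exists lam,
    (forall i, rmem s' out i =
      if i \in Z then clamped a b (rmem s lo) (rmem s up) lam i else rmem s out i) /\
    \sum_(z <- Z) clamped a b (rmem s lo) (rmem s up) lam z = rmem s rT 0).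
Proof.
move=> lo11 up11 out11 hout.
have [[C1 hC1] [C2 hC2] [C3 hC3]] :=
  And3 (run_build lo11 up11) run_search (run_write out11 hout).
exists (C1 + 2 * C2 + scost multiplier_cmd + C3)%N => R s a b Z hZ hT.
set c := nmem s vC 0.
set Q := (fun s' : state R => exists lam, _).
apply: (@run_weaken _ _ _ (C1 * c.+1 + (C2 * (2 * c).+1 + (scost multiplier_cmd + C3 * c.+1))) _ Q) => //; last first.
  have : (C2 * (2 * c).+1 <= 2 * C2 * c.+1)%N by nia.
  move: (scost _) => w; have : (w <= w * c.+1)%N by rewrite leq_pmulr.
  by rewrite !mulnDl; lia.
apply: (run_seq (hC1 R s)) => s1 fr1 [eN eI eC [eA eB] ePLO].
pose F := clamped_sum a b (rmem s lo) (rmem s up) Z.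
have eq1 x k : (x < 11)%N -> rmem s1 x k = rmem s x k.
  by move=> x11; rewrite fr1.2 // notin_above.
have T1 : rmem s1 rT 0 = rmem s rT 0 by rewrite fr1.2.
have inv1 : searching_state F (rmem s rT 0) (\sum_(z <- Z) rmem s lo z) s1.
  by split=> //; rewrite eA eB eI; apply: searching_start.
have := hC2 R _ _ _ s1 inv1; rewrite eN => h2.
apply: (run_seq h2) => s2 fr2 [inv2 nil2].
apply: (run_seq (run_multiplier inv2 nil2)) => s3 fr3 F3.
have eq3 x k : (x < 11)%N -> rmem s3 x k = rmem s x k.
  by move=> x11; rewrite fr3.2 ?fr2.2 ?eq1 // notin_above.
have c3 : nmem s3 vC 0 = c by rewrite fr3.1 // fr2.1 // fr1.1.
have Z3 : indices s3 = Z.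
  by rewrite /indices c3; apply: eq_in_mkseq => k _; rewrite fr3.1 // fr2.1 // fr1.1.
have := hC3 R s3; rewrite c3 Z3 => h3.
apply: (run_weaken h3) => // s4 _ h4; exists (rmem s3 rLAM 0); split; last exact: F3.
move=> i; rewrite h4 /clamped.
by rewrite (eq3 out) // !(eq3 3) // !(eq3 4) // !(eq3 lo) // !(eq3 up).
Qed.

(** * Blocks *)

Definition sum_step (r : nat) : cmd :=
  SetR rT (NConst 0) (RAdd (rv rT) (RGet r (NGet 4 (nv vE)))).

Definition sum_cmd (r : nat) : cmd :=
  Seq (SetR rT (NConst 0) (RConst 0))
      (for_ vE (NConst 0) (ltN (nv vE) (nv vC)) (sum_step r)).

Lemma run_sum (r : nat) : (r < 11)%N -> exists C, forall (R : realType) (s : state R),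
  run (sum_cmd r) s (C * (nmem s vC 0).+1)%N
    (fun s' => rmem s' rT 0 = \sum_(z <- indices s) rmem s r z).
Proof.
move=> r11; pose C := (scost (sum_step r) + forcost (NConst 0) (ltN (nv vE) (nv vC)))%N.
exists (3 + C)%N => R s; set c := nmem s vC 0.
pose Inv k (s' : state R) := rmem s' rT 0 = \sum_(z <- mkseq (nmem s 4) k) rmem s r z.
apply: (@run_weaken _ _ _ (3 + (c - 0).+1 * C) _ (fun s' => nmem s' vE 0 = c /\ Inv c s')).
- apply: (@run_seq _ _ _ _ _ _ (fun s1 => rmem s1 rT 0 = 0)).
    by apply: (run_sexec (c := SetR rT (NConst 0) (RConst 0))) => //; rewrite /= /upd /= mulr0z.
  move=> s1 fr1 T1; apply: (run_for_const (Inv := Inv) (n := c)) => //.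
  + by rewrite /Inv big_nil.
  + by move=> k s' fr ik _; rewrite beval_ltN /= ik fr.1 // fr1.1.
  move=> k s' fr ik kc inv; apply: run_sexec => //.
  rewrite /Inv mkseqS big_rcons /= /upd /= inv ik; congr (_ + _).
  by rewrite fr.1 // fr1.1 // fr.2 ?fr1.2 // notin_above.
- by rewrite subn0; nia.
- by move=> s' _ [].
Qed.

Definition lower_cmd : cmd :=
  Seq (sum_cmd 5) (If (ltR (rv rT) (RGet 1 (nv vJ))) (SetR rT (NConst 0) (RGet 1 (nv vJ))) Skip).

Definition upper_cmd : cmd :=
  Seq (sum_cmd 6) (If (ltR (RGet 2 (nv vJ)) (rv rT)) (SetR rT (NConst 0) (RGet 2 (nv vJ))) Skip).

Lemma run_lower : exists C, forall (R : realType) (s : state R),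
  run lower_cmd s (C * (nmem s vC 0).+1)%N (fun s' =>
    rmem s' rT 0 = Num.max (\sum_(z <- indices s) rmem s 5 z) (rmem s 1 (nmem s vJ 0))).
Proof.
have [C hC] := @run_sum 5 isT.
set c2 := If (ltR (rv rT) (RGet 1 (nv vJ))) (SetR rT (NConst 0) (RGet 1 (nv vJ))) Skip.
exists (C + scost c2)%N => R s.
set Q := (fun s' : state R => _).
apply: (@run_weaken _ _ _ (C * (nmem s vC 0).+1 + scost c2) _ Q) => //; last first.
  by rewrite mulnDl leq_add2l leq_pmulr.
apply: (run_seq (hC R s)) => s1 fr1 T1; apply: run_sexec => //.
rewrite /Q [sexec _ _]/= T1 fr1.1 // fr1.2 // -ltNge /Order.max.
by case: ifP => _ //; rewrite /= /upd.
Qed.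

Lemma run_upper : exists C, forall (R : realType) (s : state R),
  run upper_cmd s (C * (nmem s vC 0).+1)%N (fun s' =>
    rmem s' rT 0 = Num.min (rmem s 2 (nmem s vJ 0)) (\sum_(z <- indices s) rmem s 6 z)).
Proof.
have [C hC] := @run_sum 6 isT.
set c2 := If (ltR (RGet 2 (nv vJ)) (rv rT)) (SetR rT (NConst 0) (RGet 2 (nv vJ))) Skip.
exists (C + scost c2)%N => R s.
set Q := (fun s' : state R => _).
apply: (@run_weaken _ _ _ (C * (nmem s vC 0).+1 + scost c2) _ Q) => //; last first.
  by rewrite mulnDl leq_add2l leq_pmulr.
apply: (run_seq (hC R s)) => s1 fr1 T1; apply: run_sexec => //.
rewrite /Q [sexec _ _]/= T1 fr1.1 // fr1.2 // -ltNge /Order.min.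
by case: ifP => _ //; rewrite /= /upd.
Qed.

(* Linked lists: a pointer to [x] is stored as [x.+1], and 0 is the empty list. *)
Fixpoint chain (next : nat -> nat) (h : nat) (l : seq nat) : Prop :=
  if l is x :: l' then h = x.+1 /\ chain next (next x) l' else h = 0%N.

Lemma eq_chain (f g : nat -> nat) h l :
  (forall x, x \in l -> f x = g x) -> chain f h l -> chain g h l.
Proof.
elim: l h => //= x l IH h e [-> cl]; split=> //; rewrite -e ?inE ?eqxx //.
by apply: IH cl => y yl; rewrite e // inE yl orbT.
Qed.

(** The order is reversed because each index is inserted at the head of its list. *)
Definition members (blk : nat -> nat) (j n : nat) : seq nat :=
  rev [seq i <- iota 0 n | blk i == j].

Lemma membersS blk j n :
  members blk j n.+1 = if blk n == j then n :: members blk j n else members blk j n.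
Proof.
rewrite /members -addn1 iotaD filter_cat rev_cat /= add0n.
by case: ifP.
Qed.

Lemma mem_members blk j n i : (i \in members blk j n) = (i < n)%N && (blk i == j).
Proof. by rewrite mem_rev mem_filter mem_iota add0n andbC. Qed.

Lemma sum_eqn (x m : nat) : (\sum_(0 <= j < m) (x == j) = (x < m))%N.
Proof.
elim: m => [|m IH]; first by rewrite big_geq.
by rewrite big_nat_recr //= IH ltnS [in RHS]leq_eqVlt; case: eqP => [->|]; rewrite ?ltnn ?addn0.
Qed.

(** Each index adds 1 to at most one list; this makes the total cost over all blocks linear. *)
Lemma sum_size_members blk m n : (\sum_(0 <= j < m) size (members blk j n) <= n)%N.
Proof.
elim: n => [|n IH]; first by rewrite big1.
rewrite (eq_bigr (fun j => (blk n == j) + size (members blk j n))%N) => [|j _]; last first.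
  by rewrite membersS; case: ifP.
by rewrite big_split /= sum_eqn -(add1n n); apply: leq_add => //; apply: leq_b1.
Qed.

Definition list_step : cmd :=
  Seq (SetN 3 (nv vK) (NGet 2 (NGet 1 (nv vK))))
      (SetN 2 (NGet 1 (nv vK)) (NAdd (nv vK) (NConst 1))).

Definition list_cmd : cmd :=
  for_ vK (NConst 0) (ltN (nv vK) (NGet 0 (NConst 0))) list_step.

Lemma run_list : exists C, forall (R : realType) (s : state R) (n : nat),
  nmem s 0 0 = n -> (forall j, nmem s 2 j = 0%N) ->
  run list_cmd s (C * n.+1)%N (fun s' =>
    forall j, chain (nmem s' 3) (nmem s' 2 j) (members (nmem s 1) j n)).
Proof.
pose C := (scost list_step + forcost (NConst 0) (ltN (nv vK) (NGet 0 (NConst 0))))%N.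
exists C => R s n sn s0.
pose Inv k (s' : state R) :=
  forall j, chain (nmem s' 3) (nmem s' 2 j) (members (nmem s 1) j k).
apply: (@run_weaken _ _ _ ((n - 0).+1 * C) _ (fun s' => nmem s' vK 0 = n /\ Inv n s')).
- apply: (run_for_const (Inv := Inv) (n := n)) => //.
  + by move=> k s' fr ik _; rewrite beval_ltN /= ik fr.1 // sn.
  move=> k s' fr ik kn inv; apply: run_sexec => // j.
  rewrite membersS [nmem _ 3]/= [nmem _ 2 j]/= /upd /= ik addn1 !(fr.1 1%N) //.
  (* Writing the successor of [k] disturbs no existing list, since all indices listed so far are
     smaller than [k]. *)
  have old j' : chain (fun k0 => if k0 == k then nmem s' 2 (nmem s 1 k) else nmem s' 3 k0)
      (nmem s' 2 j') (members (nmem s 1) j' k).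
    apply: eq_chain (inv j') => x; rewrite mem_members => /andP[xk _].
    by rewrite ltn_eqF.
  rewrite (eq_sym j); case: eqP => [<-|_]; last exact: old.
  by split=> //; rewrite eqxx; apply: old.
- by rewrite subn0 mulnC.
- by move=> s' _ [].
Qed.

Definition gather_step : cmd :=
  Seq (SetN 4 (nv vC) (NSub (nv vPtr) (NConst 1)))
  (Seq (assign vC (NAdd (nv vC) (NConst 1)))
       (assign vPtr (NGet 3 (NSub (nv vPtr) (NConst 1))))).

Definition gather_cmd : cmd :=
  Seq (Seq (assign vC (NConst 0)) (assign vPtr (NGet 2 (nv vJ))))
      (While (ltN (NConst 0) (nv vPtr)) gather_step).

Lemma run_gather : exists C, forall (R : realType) (s : state R) (l : seq nat),
  chain (nmem s 3) (nmem s 2 (nmem s vJ 0)) l ->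
  run gather_cmd s (C * (size l).+1)%N (fun s' => indices s' = l).
Proof.
set e := ltN (NConst 0) (nv vPtr).
set c0 := Seq (assign vC (NConst 0)) (assign vPtr (NGet 2 (nv vJ))).
pose K := (scost gather_step + (bcost e).+1)%N.
exists (scost c0 + K + (bcost e).+1)%N => R s l hl.
pose Inv p (s' : state R) := exists rest, [/\ l = indices s' ++ rest,
  chain (nmem s 3) (nmem s' vPtr 0) rest & p = (size rest * K)%N].
apply: (@run_weaken _ _ _ (scost c0 + (size l * K + (bcost e).+1)) _
  (fun s' => ~~ beval s' e /\ exists p, Inv p s')); last first.
- move=> s' _ [nb [p [[|x rest] [-> hc _]]]]; first by rewrite cats0.
  by move: nb hc; rewrite beval_ltN /= => h [h' _]; rewrite h' in h.
- have : (size l * K <= (scost c0 + K + (bcost e).+1) * size l)%N.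
    by rewrite mulnC leq_mul2r -addnA addnCA leq_addr orbT.
  by rewrite mulnS; lia.
apply: (@run_seq _ _ _ _ _ _ (fun s1 => nmem s1 vC 0 = 0%N /\ nmem s1 vPtr 0 = nmem s 2 (nmem s vJ 0))).
  by apply: run_sexec.
move=> s1 fr1 [C1 P1]; apply: run_while.
  by exists l; rewrite /indices C1 P1.
move=> p s2 fr2 [rest [el hc ->]]; rewrite beval_ltN /= => ptr0.
case: rest el hc => [|x rest] el /= hc; first by rewrite hc in ptr0.
case: hc => ptr hc; exists (scost gather_step); apply: run_sexec => //.
exists (size rest * K)%N => //; exists rest; split=> //.
  rewrite el -cat_rcons; congr (_ ++ _).
  rewrite /indices /= /upd /= addn1 mkseqS eqxx ptr subSS subn0; congr rcons.
  by apply: eq_in_mkseq => k kc; rewrite ltn_eqF.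
by rewrite /= /upd /= ptr subSS subn0 fr2.1 // fr1.1.
Qed.

(** * Optimality of the composed solution *)

Lemma clamp_bounds (R : realType) (x l u : R) : l <= u -> l <= clamp x l u <= u.
Proof. by rewrite /clamp => lu; case: ltP => h; [rewrite lexx|case: ltP => h']; rewrite ?lexx ?lu ?h ?h'. Qed.

Lemma clamp_mono (R : realType) (x y l u : R) : l <= u -> x <= y -> clamp x l u <= clamp y l u.
Proof.
by move=> lu xy; rewrite /clamp; do 2 (case: ltP => ?); do ?(case: ltP => ?); lra.
Qed.

Lemma clamp_same (R : realType) (x l : R) : clamp x l l = l.
Proof. by rewrite /clamp; case: ltgtP. Qed.

Lemma clamp_lt (R : realType) (x l u : R) : x < l -> clamp x l u = l.
Proof. by rewrite /clamp => ->. Qed.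

Lemma clamp_gt (R : realType) (x l u : R) : l <= u -> u < x -> clamp x l u = u.
Proof. by rewrite /clamp => lu ux; rewrite ltNge (ltW (le_lt_trans lu ux)) ux. Qed.

Lemma clamp_id (R : realType) (x l u : R) : l <= x <= u -> clamp x l u = x.
Proof. by rewrite /clamp !ltNge => /andP[-> ->]. Qed.

Lemma clamp_eq_lower (R : realType) (x l u : R) : x < clamp x l u -> clamp x l u = l.
Proof.
rewrite /clamp; case: (ltP x l) => // _; case: (ltP u x) => [ux xu|_]; last by rewrite ltxx.
by have := lt_trans ux xu; rewrite ltxx.
Qed.

Lemma clamp_eq_upper (R : realType) (x l u : R) : clamp x l u < x -> clamp x l u = u.
Proof.
rewrite /clamp; case: (ltP x l) => [xl lx|_].
  by have := lt_trans xl lx; rewrite ltxx.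
by case: (ltP u x) => // _; rewrite ltxx.
Qed.

(** This turns bounds into multipliers: clamping between two boundary values, themselves clamped to
    [[l, u]], amounts to projecting onto [[xl, xu]] before clamping. Clamping is monotone and moves
    a point only onto an end of the interval. *)
Lemma clamp_clamp (R : realType) (x xl xu l u : R) : l <= u -> xl <= xu ->
  clamp x (clamp xl l u) (clamp xu l u) = clamp (clamp x xl xu) l u.
Proof.
move=> lu xlu; have /andP[lp pu] := clamp_bounds xl lu.
have /andP[lq qu] := clamp_bounds xu lu; have pq := clamp_mono lu xlu.
have [xxl|xlx] := ltP x xl.
  rewrite (clamp_lt xu xxl); have [/clamp_lt -> //|px] := ltP x (clamp xl l u).
  (* Here [xl] was pulled down by its clamp, which can only land on [u]; by monotonicity [xu] lands
     there too. *)
  have e := clamp_eq_upper (le_lt_trans px xxl).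
  have -> : clamp xu l u = clamp xl l u by apply/eqP; rewrite eq_le pq e qu.
  exact: clamp_same.
have [xux|xxu] := ltP xu x.
  rewrite (clamp_gt xlu xux); have [/(clamp_gt pq) -> //|xq] := ltP (clamp xu l u) x.
  have e := clamp_eq_lower (lt_le_trans xux xq).
  have -> : clamp xl l u = clamp xu l u by apply/eqP; rewrite eq_le pq e lp.
  exact: clamp_same.
rewrite (clamp_id (x := x) (l := xl)) ?xlx //.
have pr := clamp_mono lu xlx; have rq := clamp_mono lu xxu.
have [xp|px] := ltP x (clamp xl l u).
  rewrite (clamp_lt _ xp); apply/eqP; rewrite eq_le pr.
  by rewrite (clamp_eq_lower (lt_le_trans xp pr)).
have [qx|xq] := ltP (clamp xu l u) x.
  rewrite (clamp_gt pq qx); apply/eqP; rewrite eq_le rq andbT.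
  by rewrite (clamp_eq_upper (le_lt_trans rq qx)).
rewrite (clamp_id (l := clamp xl l u)) ?px //.
by rewrite (clamp_id (x := x)) // (le_trans lp px) (le_trans xq).
Qed.

Lemma clamp_affine (R : realType) (a b x l u : R) : 0 < a ->
  clamp ((x - b) / a) ((l - b) / a) ((u - b) / a) = (clamp x l u - b) / a.
Proof.
by move=> a0; rewrite /clamp !ltr_pM2r ?invr_gt0 // !ltrD2r; case: ifP => // _; case: ifP.
Qed.

(** The optimality condition of one variable as a variational inequality: no admissible direction
    decreases the quadratic with linear term shifted by [mu]. *)
Lemma clamp_variational (R : realType) (a b l u mu y : R) : 0 < a -> l <= y <= u ->
  let x := clamp ((mu - b) / a) l u in 0 <= (a * x + b - mu) * (y - x).
Proof.
move=> a0 /andP[ly yu] /=.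
have e : a * ((mu - b) / a) = mu - b by rewrite mulrC divfK // gt_eqF.
rewrite /clamp; case: ltP => h1.
  have : a * ((mu - b) / a) <= a * l by rewrite ler_pM2l // ltW.
  by rewrite e => h; apply: mulr_ge0; lra.
case: ltP => h2; last by rewrite e (_ : mu - b + b - mu = 0) ?mul0r //; ring.
have : a * u <= a * ((mu - b) / a) by rewrite ler_pM2l // ltW.
by rewrite e => h; apply: mulr_le0; lra.
Qed.

Lemma sumr_eq_le (R : realType) (T : finType) (P : pred T) (f g : T -> R) :
  (forall i, P i -> f i <= g i) -> \sum_(i | P i) g i <= \sum_(i | P i) f i ->
  forall i, P i -> f i = g i.
Proof.
move=> fg gf i Pi; apply/eqP; rewrite -subr_eq0 -oppr_eq0 opprB; apply/eqP.
apply: (psumr_eq0P (P := P) (F := fun i => g i - f i)) => // [k Pk|].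
  by rewrite subr_ge0 fg.
rewrite sumrB; apply/eqP; rewrite subr_eq0 eq_le gf.
exact: ler_sum.
Qed.

(** * Attainable block sums *)

Definition lower_target (R : realType) (n m : nat) (I : instance R n m) (j : 'I_m) : R :=
  Num.max (\sum_(i in block I j) l I i) (L I j).

Definition upper_target (R : realType) (n m : nat) (I : instance R n m) (j : 'I_m) : R :=
  Num.min (U I j) (\sum_(i in block I j) u I i).

(** A feasible point is what guarantees that both boundary problems of a block are solvable and that
    their targets are in order. *)
Lemma feasible_targets (R : realType) (n m : nat) (I : instance R n m) (y : 'I_n -> R) (j : 'I_m) :
  feasible I y ->
  [/\ \sum_(i in block I j) l I i <= lower_target I j,
   lower_target I j <= \sum_(i in block I j) y i,
   \sum_(i in block I j) y i <= upper_target I j &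
   upper_target I j <= \sum_(i in block I j) u I i].
Proof.
move=> [_ yLU ylu]; have /andP[Ly yU] := yLU j.
rewrite /lower_target /upper_target le_max lexx ge_min lexx orbT ge_max le_min Ly yU.
by rewrite !ler_sum // => i _; have /andP[] := ylu i.
Qed.

(* The two boundary solutions [xL] and [xU] of a block carry its multipliers
   [lamL] and [lamU]; the constraints on the block sum act by replacing the
   global multiplier by its projection on [[lamL, lamU]]. *)
Section Multipliers.
Variables (R : realType) (n m : nat) (I : instance R n m).
Variables (y0 : 'I_n -> R) (lamL lamU : 'I_m -> R) (xL xU : 'I_n -> R).

Let kkt (mu : R) (i : 'I_n) : R := clamp ((mu - b I i) / a I i) (l I i) (u I i).

Hypothesis y0P : feasible I y0.
Hypothesis xLE : forall i, xL i = kkt (lamL (blk I i)) i.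
Hypothesis xUE : forall i, xU i = kkt (lamU (blk I i)) i.
Hypothesis sumL : forall j, \sum_(i in block I j) xL i = lower_target I j.
Hypothesis sumU : forall j, \sum_(i in block I j) xU i = upper_target I j.

Lemma bounds_ordered i : l I i <= u I i.
Proof. by have [_ _ /(_ i) /andP[]] := y0P; apply: le_trans. Qed.

Lemma kkt_mono i mu nu : mu <= nu -> kkt mu i <= kkt nu i.
Proof.
move=> h; apply: clamp_mono; first exact: bounds_ordered.
by rewrite ler_pM2r ?invr_gt0 ?a_gt0 // lerD2r.
Qed.

Lemma targets_le j : lower_target I j <= upper_target I j.
Proof. by have [_ h1 h2 _] := feasible_targets j y0P; apply: le_trans h1 h2. Qed.

(** With inverted multipliers monotonicity gives [xU <= xL] on the whole block, while the sums are
    ordered the other way; hence equality holds termwise. *)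
Lemma boundary_eq i : lamU (blk I i) < lamL (blk I i) -> xU i = xL i.
Proof.
set j := blk I i => hj; apply: (sumr_eq_le (P := fun k => k \in block I j)) => [k| |].
- by rewrite inE => /eqP kj; rewrite xLE xUE kj kkt_mono // ltW.
- by rewrite [leLHS]sumL [leRHS]sumU targets_le.
- by rewrite inE.
Qed.

Lemma boundary_le i : xL i <= xU i.
Proof.
have [h|/boundary_eq -> //] := leP (lamL (blk I i)) (lamU (blk I i)).
by rewrite xLE xUE kkt_mono.
Qed.

Variables (lam : R) (x : 'I_n -> R).
Hypothesis xE : forall i, x i = clamp ((lam - b I i) / a I i) (xL i) (xU i).
Hypothesis sumx : \sum_i x i = res I.
Hypothesis w0 : forall j, w I j = 0.

(** If the multipliers are inverted, [xL] and [xU] agree on the block, and [lamL j] is one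
    multiplier that describes both. *)
Let mu j := if lamL j <= lamU j then clamp lam (lamL j) (lamU j) else lamL j.

(** In the regular case this is [clamp_clamp] along the increasing affine map from multipliers to
    unclamped values. *)
Lemma x_kkt i : x i = kkt (mu (blk I i)) i.
Proof.
rewrite xE /mu; case: leP => h; last by rewrite (boundary_eq h) clamp_same xLE.
rewrite xLE xUE clamp_clamp ?bounds_ordered //; first by rewrite clamp_affine ?a_gt0.
by rewrite ler_pM2r ?invr_gt0 ?a_gt0 // lerD2r.
Qed.

Lemma x_bounds i : xL i <= x i <= xU i.
Proof. by rewrite xE clamp_bounds // boundary_le. Qed.

Lemma x_sum_bounds j :
  lower_target I j <= \sum_(i in block I j) x i <= upper_target I j.
Proof.
by rewrite -sumL -sumU !ler_sum // => i _; have /andP[] := x_bounds i.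
Qed.

Lemma x_feasible : feasible I x.
Proof.
split=> // [j|i].
  have /andP[h1 h2] := x_sum_bounds j; apply/andP; split.
    by apply: le_trans h1; rewrite le_max lexx orbT.
  by apply: le_trans h2 _; rewrite ge_min lexx.
by rewrite x_kkt; apply: clamp_bounds; apply: bounds_ordered.
Qed.

(** The projection raises the multiplier only if [lam] lies below [lamL j]; then [x] equals [xL] on
    the block and its sum is the smallest attainable one, so both factors are nonnegative. Lowering
    is symmetric. *)
Lemma block_complementarity j (Y : R) : lower_target I j <= Y <= upper_target I j ->
  0 <= (mu j - lam) * (Y - \sum_(i in block I j) x i).
Proof.
move=> /andP[LY YU]; have /andP[LX XU] := x_sum_bounds j.
have at_lower : (forall i, i \in block I j -> x i = xL i) ->
    \sum_(i in block I j) x i = lower_target I j.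
  by move=> h; rewrite -sumL; apply: eq_bigr.
have at_upper : (forall i, i \in block I j -> x i = xU i) ->
    \sum_(i in block I j) x i = upper_target I j.
  by move=> h; rewrite -sumU; apply: eq_bigr.
have [h|h] := leP (lamL j) (lamU j); last first.
  have e i : i \in block I j -> xU i = xL i.
    by rewrite inE => /eqP ij; apply: boundary_eq; rewrite ij.
  (* In the inverted case both targets coincide, so every attainable block sum is the same. *)
  have eX : \sum_(i in block I j) x i = Y.
    have e1 : \sum_(i in block I j) x i = lower_target I j.
      by apply: at_lower => i ij; rewrite xE (e i ij) clamp_same.
    have e2 : \sum_(i in block I j) x i = upper_target I j.
      by apply: at_upper => i ij; rewrite xE (e i ij) clamp_same.
    by apply/eqP; rewrite eq_le {1}e1 LY e2 YU.
  by rewrite eX subrr mulr0.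
have mE : mu j = clamp lam (lamL j) (lamU j) by rewrite /mu h.
rewrite mE; move: mE; rewrite /clamp; case: ltP => h1 mE.
  rewrite at_lower => [|i]; first by apply: mulr_ge0; lra.
  by rewrite inE => /eqP ij; rewrite x_kkt xLE ij mE.
move: mE; case: ltP => h2 mE; last by rewrite subrr mul0r.
rewrite at_upper => [|i]; first by apply: mulr_le0; lra.
by rewrite inE => /eqP ij; rewrite x_kkt xUE ij mE.
Qed.

(** The difference of the objectives is the gradient term plus half the weighted squares. The
    gradient [a * x + b] splits into [a * x + b - mu], [mu - lam] and [lam]: the first is handled by
    the bounds on single variables, the second by the block constraints, and the last vanishes by
    the common sum. *)
Lemma x_optimal : optimal I x.
Proof.
split=> [|y yP]; first exact: x_feasible.
have [sumy yLU ylu] := yP.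
rewrite /objective [X in X + _]big1 => [|j _]; last by rewrite w0 mulr0 mul0r.
rewrite [X in _ <= X + _]big1 => [|j _]; last by rewrite w0 mulr0 mul0r.
rewrite !add0r -subr_ge0 -sumrB.
have blocks : 0 <= \sum_i (mu (blk I i) - lam) * (y i - x i).
  rewrite (partition_big (blk I) xpredT) //=; apply: sumr_ge0 => j _.
  rewrite (eq_bigr (fun i => (mu j - lam) * (y i - x i))) => [|i /eqP -> //].
  rewrite -mulr_sumr sumrB.
  have e (f : 'I_n -> R) : \sum_(i | blk I i == j) f i = \sum_(i in block I j) f i.
    by apply: eq_bigl => i; rewrite inE.
  rewrite !e; apply: block_complementarity.
  by have [_ -> -> _] := feasible_targets j yP.
have total : \sum_i lam * (y i - x i) = 0.
  by rewrite -mulr_sumr sumrB sumy sumx subrr mulr0.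
have kkts : 0 <= \sum_i (a I i * x i + b I i - mu (blk I i)) * (y i - x i).
  by apply: sumr_ge0 => i _; rewrite x_kkt; apply: clamp_variational; rewrite ?a_gt0.
have squares : 0 <= \sum_i 2^-1 * a I i * (y i - x i) ^+ 2.
  apply: sumr_ge0 => i _; apply: mulr_ge0; last exact: sqr_ge0.
  by rewrite mulr_ge0 ?invr_ge0 // ltW // a_gt0.
have := addr_ge0 (addr_ge0 blocks kkts) squares.
set S := (_ + _ + _) => S0.
suff -> : \sum_i (2^-1 * a I i * y i ^+ 2 + b I i * y i -
    (2^-1 * a I i * x i ^+ 2 + b I i * x i)) = S + \sum_i lam * (y i - x i).
  by rewrite total addr0.
by rewrite /S -!big_split; apply: eq_bigr => i _ /=; field.
Qed.

End Multipliers.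

(** * Running through the blocks *)

Definition block_cmd : cmd :=
  Seq gather_cmd (Seq lower_cmd (Seq (solve_cmd 5 6 9) (Seq upper_cmd (solve_cmd 5 6 10)))).

Definition solved (R : realType) (s : state R) (lo up out : nat) (Z : seq nat) (T : R)
    (s' : state R) : Prop :=
  exists lam, (forall i, rmem s' out i =
      if i \in Z then clamped (rmem s 3) (rmem s 4) (rmem s lo) (rmem s up) lam i
      else rmem s out i) /\
    \sum_(z <- Z) clamped (rmem s 3) (rmem s 4) (rmem s lo) (rmem s up) lam z = T.

Definition valid_block (R : realType) (s : state R) (j : nat) (Z : seq nat) : Prop :=
  [/\ forall z, z \in Z -> 0 < rmem s 3 z /\ rmem s 5 z <= rmem s 6 z,
   rmem s 1 j <= \sum_(z <- Z) rmem s 6 z &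
   \sum_(z <- Z) rmem s 5 z <= rmem s 2 j].

(** Each call of [solve_cmd] refers to the state in which it starts; this traces the result back to
    the state before the whole block was treated. *)
Lemma solved_frame (R : realType) (c : cmd) (s1 s2 s : state R) lo up out Z T :
  frame c s1 s2 -> all (fun x => x \notin rmods c) [:: 3; 4; lo; up; out]%N ->
  solved s2 lo up out Z T s -> solved s1 lo up out Z T s.
Proof.
move=> fr /and5P[h3 h4 hlo hup /andP[hout _]] [lam [h1 h2]].
have e x k : x \notin rmods c -> rmem s2 x k = rmem s1 x k by move=> h; rewrite fr.2.
have ec z : clamped (rmem s2 3) (rmem s2 4) (rmem s2 lo) (rmem s2 up) lam z =
    clamped (rmem s1 3) (rmem s1 4) (rmem s1 lo) (rmem s1 up) lam z.
  by rewrite /clamped !e.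
exists lam; split=> [i|]; first by rewrite h1 ec e.
by rewrite -h2; apply: eq_bigr => z _; rewrite ec.
Qed.

Lemma run_block : exists C, forall (R : realType) (s : state R) (Z : seq nat),
  chain (nmem s 3) (nmem s 2 (nmem s vJ 0)) Z -> valid_block s (nmem s vJ 0) Z ->
  run block_cmd s (C * (size Z).+1)%N (fun s' =>
    solved s 5 6 9 Z (Num.max (\sum_(z <- Z) rmem s 5 z) (rmem s 1 (nmem s vJ 0))) s' /\
    solved s 5 6 10 Z (Num.min (rmem s 2 (nmem s vJ 0)) (\sum_(z <- Z) rmem s 6 z)) s').
Proof.
have [[C1 hC1] [C2 hC2] [C3 hC3] [C4 hC4] [C5 hC5]] :=
  And5 run_gather run_lower (@run_solve 5 6 9 isT isT isT isT) run_upper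
    (@run_solve 5 6 10 isT isT isT isT).
exists (C1 + C2 + C3 + C4 + C5)%N => R s Z hZ; set j := nmem s vJ 0 => -[lu LU UL].
set c := (size Z).+1; set Q := (fun s' : state R => _).
have lu_sum : \sum_(z <- Z) rmem s 5 z <= \sum_(z <- Z) rmem s 6 z.
  by rewrite big_seq [leRHS]big_seq; apply: ler_sum => z /lu [].
apply: (@run_weaken _ _ _ (C1 * c + (C2 * c + (C3 * c + (C4 * c + C5 * c)))) _ Q) => //; last first.
  by rewrite !mulnDl; lia.
apply: (run_seq (hC1 R s Z hZ)) => s1 fr1 Z1.
have cZ (s' : state R) : indices s' = Z -> (nmem s' vC 0).+1 = c.
  by move=> e; rewrite /c -e size_mkseq.
have e1 x k : rmem s1 x k = rmem s x k by rewrite fr1.2.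
have j1 : nmem s1 vJ 0 = j by rewrite fr1.1.
have h2 := hC2 R s1; rewrite (cZ _ Z1) Z1 j1 in h2.
apply: (run_seq h2) => s2 fr2 T2.
have Zfr (d : cmd) (s' s'' : state R) : frame d s' s'' -> 4 \notin nmods d -> 5 \notin nmods d ->
    indices s' = Z -> indices s'' = Z.
  move=> fr h4 h5 <-; rewrite /indices fr.1 //.
  by apply: eq_in_mkseq => k _; rewrite fr.1.
have Z2 : indices s2 = Z by apply: Zfr fr2 _ _ Z1.
have e2 x k : (x < 11)%N -> rmem s2 x k = rmem s x k.
  by move=> x11; rewrite fr2.2 ?e1 // notin_above.
have sum2 x : (x < 11)%N -> \sum_(z <- Z) rmem s2 x z = \sum_(z <- Z) rmem s x z.
  by move=> x11; apply: eq_bigr => z _; rewrite e2.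
have sum1 x : \sum_(z <- Z) rmem s1 x z = \sum_(z <- Z) rmem s x z.
  by apply: eq_bigr => z _; rewrite e1.
rewrite sum1 e1 in T2.
have h3 := hC3 R s2; rewrite /= (cZ _ Z2) Z2 in h3.
have p3 : forall z, z \in Z -> 0 < rmem s2 3 z /\ rmem s2 5 z <= rmem s2 6 z.
  by move=> z zZ; rewrite !e2 //; apply: lu.
have q3 : \sum_(z <- Z) rmem s2 5 z <= rmem s2 rT 0 <= \sum_(z <- Z) rmem s2 6 z.
  by rewrite !sum2 // T2 le_max lexx ge_max lu_sum LU.
apply: (run_seq (h3 p3 q3)) => s3 fr3 S3.
have Z3 : indices s3 = Z by apply: Zfr fr3 _ _ Z2.
have e3 x k : (x < 9)%N -> rmem s3 x k = rmem s x k.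
  move=> x9; rewrite fr3.2 ?e2 //; first by apply: leq_trans x9 _.
  by apply/negP => /(allP (isT : all (leq 9) (rmods (solve_cmd 5 6 9)))); rewrite leqNgt x9.
have j3 : nmem s3 vJ 0 = j by rewrite fr3.1 // fr2.1.
have h4 := hC4 R s3; rewrite (cZ _ Z3) Z3 j3 in h4.
apply: (run_seq h4) => s4 fr4 T4.
have Z4 : indices s4 = Z by apply: Zfr fr4 _ _ Z3.
have e4 x k : (x < 9)%N -> rmem s4 x k = rmem s x k.
  by move=> x9; rewrite fr4.2 ?e3 // notin_above // (leq_trans x9).
have sum4 x : (x < 9)%N -> \sum_(z <- Z) rmem s4 x z = \sum_(z <- Z) rmem s x z.
  by move=> x9; apply: eq_bigr => z _; rewrite e4.
have sum3 x : (x < 9)%N -> \sum_(z <- Z) rmem s3 x z = \sum_(z <- Z) rmem s x z.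
  by move=> x9; apply: eq_bigr => z _; rewrite e3.
rewrite sum3 // e3 // in T4.
have h5 := hC5 R s4; rewrite /= (cZ _ Z4) Z4 in h5.
have p5 : forall z, z \in Z -> 0 < rmem s4 3 z /\ rmem s4 5 z <= rmem s4 6 z.
  by move=> z zZ; rewrite !e4 //; apply: lu.
have q5 : \sum_(z <- Z) rmem s4 5 z <= rmem s4 rT 0 <= \sum_(z <- Z) rmem s4 6 z.
  by rewrite !sum4 // T4 ge_min le_min lexx lu_sum UL orbT.
apply: (run_weaken (h5 p5 q5)) => // s5 fr5 S5; split.
  have {}S3 : solved s2 5 6 9 Z (rmem s2 rT 0) s3 by [].
  rewrite T2 in S3.
  move/(solved_frame fr2 (lo := 5) (up := 6) (out := 9) isT): S3.
  move/(solved_frame fr1 (lo := 5) (up := 6) (out := 9) isT) => [lam [hx hs]].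
  by exists lam; split=> // i; rewrite -hx fr5.2 // fr4.2.
have {}S5 : solved s4 5 6 10 Z (rmem s4 rT 0) s5 by [].
rewrite T4 in S5.
move/(solved_frame fr4 (lo := 5) (up := 6) (out := 10) isT): S5.
move/(solved_frame fr3 (lo := 5) (up := 6) (out := 10) isT).
move/(solved_frame fr2 (lo := 5) (up := 6) (out := 10) isT).
exact: (solved_frame fr1 (lo := 5) (up := 6) (out := 10) isT).
Qed.

Definition blocks_cmd : cmd :=
  for_ vJ (NConst 0) (ltN (nv vJ) (NGet 0 (NConst 1))) block_cmd.

(** Only stored values at the indices of block [j] are mentioned, so the statement survives the
    treatment of later blocks. *)
Definition boundary_solution (R : realType) (s : state R) (n j : nat) (out : nat) (T : R)
    (s' : state R) : Prop :=
  exists lam, (forall i, (i < n)%N -> nmem s 1 i = j ->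
      rmem s' out i = clamped (rmem s 3) (rmem s 4) (rmem s 5) (rmem s 6) lam i) /\
    \sum_(z <- members (nmem s 1) j n) rmem s' out z = T.

(** Block [j] costs its size plus one, up to a constant; the extra one per block is the source of
    [m] in the bound. *)
Lemma run_blocks : exists C, forall (R : realType) (s : state R) (n m : nat),
  nmem s 0 1 = m ->
  (forall j, chain (nmem s 3) (nmem s 2 j) (members (nmem s 1) j n)) ->
  (forall j, (j < m)%N -> valid_block s j (members (nmem s 1) j n)) ->
  run blocks_cmd s (C * (n + m).+1)%N (fun s' => forall j, (j < m)%N ->
    let Z := members (nmem s 1) j n in
    boundary_solution s n j 9 (Num.max (\sum_(z <- Z) rmem s 5 z) (rmem s 1 j)) s' /\
    boundary_solution s n j 10 (Num.min (rmem s 2 j) (\sum_(z <- Z) rmem s 6 z)) s').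
Proof.
have [C hC] := run_block.
pose D := forcost (NConst 0) (ltN (nv vJ) (NGet 0 (NConst 1))).
exists (C + D)%N => R s n m sm hchain hvalid.
pose Z j := members (nmem s 1) j n.
pose Inv k (s' : state R) := forall j, (j < k)%N ->
    boundary_solution s n j 9 (Num.max (\sum_(z <- Z j) rmem s 5 z) (rmem s 1 j)) s' /\
    boundary_solution s n j 10 (Num.min (rmem s 2 j) (\sum_(z <- Z j) rmem s 6 z)) s'.
apply: (@run_weaken _ _ _ (\sum_(0 <= j < m) C * (size (Z j)).+1 + (m - 0).+1 * D) _
  (fun s' => nmem s' vJ 0 = m /\ Inv m s')); last by move=> s' _ [].
  apply: (run_for (Inv := Inv) (n := m) (K := fun j => (C * (size (Z j)).+1)%N)) => //.
    by move=> k s' fr ik _; rewrite beval_ltN /= ik fr.1 // sm.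
  move=> j s' fr ij /= jm inv.
  have er x k : (x < 9)%N -> rmem s' x k = rmem s x k.
    move=> x9; rewrite fr.2 //.
    by apply/negP => /(allP (isT : all (leq 9) (rmods blocks_cmd))); rewrite leqNgt x9.
  have es x j' : (x < 9)%N -> \sum_(z <- Z j') rmem s' x z = \sum_(z <- Z j') rmem s x z.
    by move=> x9; apply: eq_bigr => z _; rewrite er.
  have hc : chain (nmem s' 3) (nmem s' 2 (nmem s' vJ 0)) (Z j).
    rewrite ij fr.1 //; apply: eq_chain (hchain j) => y _.
    by rewrite fr.1.
  have hv : valid_block s' (nmem s' vJ 0) (Z j).
    have [v1 v2 v3] := hvalid j jm; rewrite ij; split; rewrite ?es ?er //.
    by move=> z zZ; rewrite !er //; apply: v1.
  apply: (run_weaken (hC R s' _ hc hv)) => // s2 fr2 [sL sU] j'.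
  have ec lam z : clamped (rmem s' 3) (rmem s' 4) (rmem s' 5) (rmem s' 6) lam z =
      clamped (rmem s 3) (rmem s 4) (rmem s 5) (rmem s 6) lam z.
    by rewrite /clamped !er.
  have new out T : solved s' 5 6 out (Z j) T s2 -> boundary_solution s n j out T s2.
    move=> [lam [h1 h2]]; exists lam; split=> [i ltin ij'|].
      by rewrite h1 mem_members ltin ij' eqxx /= ec.
    by rewrite -h2 big_seq [RHS]big_seq; apply: eq_bigr => z zZ; rewrite h1 zZ.
  (* An index belongs to one block only, so treating block [j] leaves the entries of an earlier
     block [j'] unchanged. *)
  have old out T U : (j' < j)%N -> solved s' 5 6 out (Z j) U s2 ->
      boundary_solution s n j' out T s' -> boundary_solution s n j' out T s2.
    move=> jj' [lam' [h1' _]] [lam [h1 h2]].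
    have e i : nmem s 1 i = j' -> rmem s2 out i = rmem s' out i.
      by move=> ij'; rewrite h1' mem_members ij' ltn_eqF // andbF.
    exists lam; split=> [i ltin ij'|]; first by rewrite e // h1.
    rewrite -h2 big_seq [RHS]big_seq; apply: eq_bigr => z.
    by rewrite mem_members => /andP[_ /eqP ?]; apply: e.
  rewrite ltnS leq_eqVlt => /orP[/eqP ->|jj'].
    by rewrite ij !es // !er // in sL sU; split; apply: new.
  by have [oL oU] := inv j' jj'; split; [apply: old sL oL|apply: old sU oU].
rewrite -big_distrr /= (eq_bigr (fun j => size (Z j) + 1)%N) => [|j _]; last by rewrite addn1.
rewrite big_split /= sum_nat_const_nat subn0 muln1.
have := sum_size_members (nmem s 1) m n; rewrite -/Z => hs.
have : (C * (\sum_(0 <= j < m) size (Z j) + m) <= C * (n + m))%N.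
  by rewrite leq_mul2l leq_add2r hs orbT.
by nia.
Qed.

(** * The complete program *)

(** The index list becomes [0, ..., n - 1], and the arrays 9 and 10 with the boundary solutions take
    the place of the bounds. *)
Definition final_cmd : cmd :=
  Seq (for_ vK (NConst 0) (ltN (nv vK) (NGet 0 (NConst 0))) (SetN 4 (nv vK) (nv vK)))
  (Seq (Seq (assign vC (NGet 0 (NConst 0))) (SetR rT (NConst 0) (RGet 7 (NConst 0))))
       (solve_cmd 9 10 8)).

Lemma run_final : exists C, forall (R : realType) (s : state R) (n : nat),
  nmem s 0 0 = n ->
  (forall z, (z < n)%N -> 0 < rmem s 3 z /\ rmem s 9 z <= rmem s 10 z) ->
  \sum_(z <- iota 0 n) rmem s 9 z <= rmem s 7 0 <= \sum_(z <- iota 0 n) rmem s 10 z ->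
  run final_cmd s (C * n.+1)%N (fun s' => exists lam,
    (forall i, (i < n)%N ->
      rmem s' 8 i = clamped (rmem s 3) (rmem s 4) (rmem s 9) (rmem s 10) lam i) /\
    \sum_(z <- iota 0 n) clamped (rmem s 3) (rmem s 4) (rmem s 9) (rmem s 10) lam z =
      rmem s 7 0).
Proof.
have [C1 hC1] := @run_solve 9 10 8 isT isT isT isT.
set b := SetN 4 (nv vK) (nv vK); set e := ltN (nv vK) (NGet 0 (NConst 0)).
set c2 := Seq (assign vC (NGet 0 (NConst 0))) (SetR rT (NConst 0) (RGet 7 (NConst 0))).
pose D := (scost b + forcost (NConst 0) e)%N.
exists (D + scost c2 + C1)%N => R s n sn hz hT.
set Q := (fun s' : state R => _).
apply: (@run_weaken _ _ _ ((n - 0).+1 * D + (scost c2 + C1 * n.+1)) _ Q) => //; last first.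
  have cost d k x : (n.+1 * d + (k + x * n.+1) <= (d + k + x) * n.+1)%N by nia.
  by rewrite subn0; apply: cost.
pose Inv k (s' : state R) := forall j, (j < k)%N -> nmem s' 4 j = j.
have h1 : run (for_ vK (NConst 0) e b) s ((n - 0).+1 * D)%N
    (fun s' => nmem s' vK 0 = n /\ Inv n s').
  apply: (run_for_const (Inv := Inv) (n := n)) => //.
    by move=> k s' fr ik _; rewrite beval_ltN /= ik fr.1 // sn.
  move=> k s' fr ik _ inv; apply: run_sexec => // j.
  rewrite ltnS leq_eqVlt /= /upd /= ik; case: eqP => [->|_] //=; exact: inv.
apply: (run_seq h1) => s1 fr1 [_ Z1].
have h2 : run c2 s1 (scost c2) (fun s' => nmem s' vC 0 = n /\ rmem s' rT 0 = rmem s 7 0).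
  by apply: run_sexec => //; rewrite /= /upd /= fr1.1 // fr1.2.
apply: (run_seq h2) => s2 fr2 [C2 T2].
have er x k : (x < 11)%N -> rmem s2 x k = rmem s x k.
  by move=> x11; rewrite fr2.2 ?fr1.2 // notin_above.
have Z2 : indices s2 = iota 0 n.
  rewrite /indices C2 -[RHS](map_id) -[in RHS]/(mkseq id n).
  by apply: eq_in_mkseq => k kn; rewrite fr2.1 // Z1.
have es x : (x < 11)%N -> \sum_(z <- iota 0 n) rmem s2 x z = \sum_(z <- iota 0 n) rmem s x z.
  by move=> x11; apply: eq_bigr => z _; rewrite er.
have ec lam z : clamped (rmem s2 3) (rmem s2 4) (rmem s2 9) (rmem s2 10) lam z =
    clamped (rmem s 3) (rmem s 4) (rmem s 9) (rmem s 10) lam z.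
  by rewrite /clamped !er.
have h3 := hC1 R s2; rewrite /= C2 Z2 T2 !es // in h3.
have p3 z : z \in iota 0 n -> 0 < rmem s2 3 z /\ rmem s2 9 z <= rmem s2 10 z.
  by rewrite mem_iota add0n !er //; apply: hz.
apply: (run_weaken (h3 p3 hT)) => // s3 _ [lam [hx hs]]; exists lam; split=> [i ltin|].
  by rewrite hx mem_iota add0n ltin ec.
by rewrite -hs; apply: eq_bigr => z _; rewrite ec.
Qed.

Definition main_cmd : cmd := Seq list_cmd (Seq blocks_cmd final_cmd).

Lemma load_ord (T : Type) (d : T) (p : nat) (f : 'I_p -> T) (i : 'I_p) : load d f i = f i.
Proof. by rewrite /load valK. Qed.

Lemma sum_iota (R : realType) (n : nat) (P : pred nat) (g : nat -> R) :
  \sum_(z <- iota 0 n | P z) g z = \sum_(i < n | P i) g i.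
Proof. by rewrite -(big_mkord P) /index_iota subn0. Qed.

Lemma sum_members (R : realType) (blk : nat -> nat) (j n : nat) (g : nat -> R) :
  \sum_(z <- members blk j n) g z = \sum_(i < n | blk i == j) g i.
Proof.
rewrite (perm_big [seq i <- iota 0 n | blk i == j]) ?big_filter /=; first exact: sum_iota.
by rewrite perm_rev.
Qed.

(** Choosing one index from each nonempty block is injective; this reduces the bound in [n + m] to
    one in [n]. *)
Lemma leq_blocks (R : realType) (n m : nat) (I : instance R n m) : (m <= n)%N.
Proof.
have [g gK] := fin_all_exists (blk_surj I).
by have := leq_card g (can_inj gK); rewrite !card_ord.
Qed.

Lemma run_main : exists C, forall (R : realType) (n m : nat) (I : instance R n m),
  (exists x, feasible I x) -> (forall j, w I j = 0) ->
  run main_cmd (init I) (C * n.+1)%N (fun s => optimal I (output s)).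
Proof.
have [[C1 hC1] [C2 hC2] [C3 hC3]] := And3 run_list run_blocks run_final.
exists (C1 + 2 * C2 + C3)%N => R n m I [y yP] w0.
apply: (@run_weaken _ _ _ (C1 * n.+1 + (C2 * (n + m).+1 + C3 * n.+1)) _
  (fun s => optimal I (output s))) => //; last first.
  have mn := leq_blocks I.
  have : (C2 * (n + m).+1 <= 2 * C2 * n.+1)%N by rewrite (mulnC 2) -mulnA leq_mul2l; lia.
  by rewrite !mulnDl; lia.
set s := init I.
have sum_block (g : nat -> R) (j : 'I_m) :
    \sum_(z <- members (nmem s 1) j n) g z = \sum_(i in block I j) g i.
  rewrite sum_members; apply: eq_bigl => i.
  by rewrite inE /= load_ord.
have [ysum yLU ylu] := yP.
have validP j : (j < m)%N -> valid_block s j (members (nmem s 1) j n).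
  move=> jm; pose j' := Ordinal jm; have [f1 f2 f3 f4] := feasible_targets j' yP.
  split=> [z||].
  - rewrite mem_members => /andP[zn _]; pose i := Ordinal zn.
    rewrite /= -[z]/(val i) !load_ord a_gt0; split=> //.
    by have /andP[] := ylu i; apply: le_trans.
  - rewrite (sum_block _ j') /= -[j]/(val j') load_ord.
    rewrite (eq_bigr (u I)) => [|i _]; last by rewrite load_ord.
    by have /andP[h _] := yLU j'; apply: le_trans h (le_trans f3 f4).
  - rewrite (sum_block _ j') /= -[j]/(val j') load_ord.
    rewrite (eq_bigr (l I)) => [|i _]; last by rewrite load_ord.
    by have /andP[_ h] := yLU j'; apply: le_trans (le_trans f1 f2) h.
apply: (run_seq (hC1 R s n erefl (fun=> erefl))) => s1 fr1 chain1.
have e1 x k : rmem s1 x k = rmem s x k by rewrite fr1.2.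
have n1 : nmem s1 1 =1 nmem s 1 by move=> k; rewrite fr1.1.
have memb j : members (nmem s1 1) j n = members (nmem s 1) j n.
  by rewrite /members (eq_filter (a2 := fun i => nmem s 1 i == j)) // => i; rewrite n1.
have sum1 x Z : \sum_(z <- Z) rmem s1 x z = \sum_(z <- Z) rmem s x z.
  by apply: eq_bigr => z _; rewrite e1.
have chainP j : chain (nmem s1 3) (nmem s1 2 j) (members (nmem s1 1) j n).
  by rewrite memb.
have validP1 j : (j < m)%N -> valid_block s1 j (members (nmem s1 1) j n).
  move=> /validP [v1 v2 v3]; rewrite memb; split; rewrite ?sum1 ?e1 //.
  by move=> z /v1; rewrite !e1.
have m1 : nmem s1 0 1 = m by rewrite fr1.1.
apply: (run_seq (hC2 R s1 n m m1 chainP validP1)) => s2 fr2 bd.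
have e2 x k : (x < 9)%N -> rmem s2 x k = rmem s x k.
  move=> x9; rewrite fr2.2 ?e1 //.
  by apply/negP => /(allP (isT : all (leq 9) (rmods blocks_cmd))); rewrite leqNgt x9.
pose at_target out (T : 'I_m -> R) j lam :=
  (forall i : 'I_n, blk I i = j ->
    rmem s2 out i = clamp ((lam - b I i) / a I i) (l I i) (u I i)) /\
  \sum_(i in block I j) rmem s2 out i = T j.
have loc out T t (j : 'I_m) : boundary_solution s1 n j out t s2 -> t = T j ->
    exists lam, at_target out T j lam.
  move=> [lam [h1 h2]] tT; exists lam; split=> [i ij|].
    rewrite h1 ?ltn_ord //; first by rewrite /clamped !e1 /= !load_ord.
    by rewrite n1 /= load_ord ij.
  by rewrite -tT -h2 memb sum_block.
(* Finite choice collects the multipliers of the single blocks into one function. *)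
have [lamL hL] : exists lamL : 'I_m -> R, forall j,
    at_target 9 (lower_target I) j (lamL j).
  apply: (@fin_all_exists _ _ (at_target 9 (lower_target I))) => j.
  have [h _] := bd j (ltn_ord j); apply: loc h _; rewrite memb sum1 e1 sum_block.
  by rewrite /= load_ord; congr Num.max; apply: eq_bigr => i _; rewrite load_ord.
have [lamU hU] : exists lamU : 'I_m -> R, forall j,
    at_target 10 (upper_target I) j (lamU j).
  apply: (@fin_all_exists _ _ (at_target 10 (upper_target I))) => j.
  have [_ h] := bd j (ltn_ord j); apply: loc h _; rewrite memb sum1 e1 sum_block.
  by rewrite /= load_ord; congr Num.min; apply: eq_bigr => i _; rewrite load_ord.
have xLE i := (hL (blk I i)).1 i erefl.
have xUE i := (hU (blk I i)).1 i erefl.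
have sumL j := (hL j).2.
have sumU j := (hU j).2.
have LU := boundary_le yP xLE xUE sumL sumU.
have sum_blocks (f : 'I_n -> R) : \sum_i f i = \sum_j \sum_(i in block I j) f i.
  rewrite (partition_big (blk I) xpredT) //=; apply: eq_bigr => j _.
  by apply: eq_bigl => i; rewrite inE.
have n2 : nmem s2 0 0 = n by rewrite fr2.1 // fr1.1.
have hz z : (z < n)%N -> 0 < rmem s2 3 z /\ rmem s2 9 z <= rmem s2 10 z.
  move=> zn; have := LU (Ordinal zn); split=> //.
  by rewrite e2 //= -[z]/(val (Ordinal zn)) load_ord a_gt0.
(* Each block sum of the feasible point [y] lies between the two targets, so its total, the
   resource, lies between their sums. *)
have hT : \sum_(z <- iota 0 n) rmem s2 9 z <= rmem s2 7 0 <= \sum_(z <- iota 0 n) rmem s2 10 z.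
  rewrite !(sum_iota _ xpredT) !sum_blocks e2 //= -ysum sum_blocks.
  by apply/andP; split; apply: ler_sum => j _; have [_ h1 h2 _] := feasible_targets j yP;
    rewrite ?sumL ?sumU.
apply: (run_weaken (hC3 R s2 n n2 hz hT)) => // s3 _ [lam [hx hs]].
have xE (i : 'I_n) : output s3 i = clamp ((lam - b I i) / a I i) (rmem s2 9 i) (rmem s2 10 i).
  by rewrite /output hx // /clamped !(e2 3%N) // !(e2 4%N) //= !load_ord.
apply: (x_optimal yP xLE xUE sumL sumU xE) => //.
rewrite -[RHS](e2 7%N 0%N isT) -hs (sum_iota _ xpredT); apply: eq_bigr => i _.
exact: hx.
Qed.

Theorem theorem4 (R : realType) :
  exists (p : program) (C : nat),
    forall (n m : nat) (I : instance R n m),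
      (0 < n)%N ->
      (exists x : 'I_n -> R, feasible I x) ->
      (forall j : 'I_m, w I j = 0) ->
      exists (t : nat) (s : state R),
        [/\ exec (procs p) (main p) (init I) t s,
            (t <= C * n)%N &
            optimal I (output s)].
Proof.
have [C hC] := run_main.
(* The factor 2 absorbs the additive constant: [n + 1 <= 2n] for positive [n]. *)
exists (Program main_cmd [::]), (2 * C)%N => n m I n0 feas w0.
have [t [s [h tC opt]]] := hC R n m I feas w0.
exists t, s; split=> //; apply: leq_trans tC _.
by rewrite (mulnC 2) -mulnA leq_mul2l; lia.
Qed.
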